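(* Let $I=\{(1,3),(2,1),(3,2)\}$, let $P:L(3)\to\mathbf{R}$ and $P_1:L_I\to\mathbf{R}$ be the polynomials given in the context, and let $P_I$ be the restriction of $P$ to $L_I$. Then $P_I$ admits the factorization $$P_I=P_1^2P_2,$$ where $P_2$ is a homogeneous polynomial of degree 12 with integer coefficients (in the real and imaginary parts of $x,y,z,u,v$). Thus $\Gamma\cap L_I=\Gamma_1\cup\Gamma_2$, where $\Gamma\subset L(3)$ is the hypersurface $P=0$, and $\Gamma_1,\Gamma_2\subset L_I$ are the hypersurfaces $P_1=0$ and $P_2=0$, respectively. Moreover $\Theta\subseteq\Gamma$.
   Context: $L(3)$ is the space of traceless complex $3\times3$ matrices; $L_I\subset L(3)$ is the subspace of matrices with zero entries at positions $(1,3),(2,1),(3,2)$, i.e. matrices $$A=\begin{pmatrix} u & z & 0 \\ 0 & v & x \\ y & 0 & w \end{pmatrix},\qquad w=-u-v,\ x,y,z,u,v\in\mathbf{C}.$$ $\mathcal{O}_A=\{UAU^{-1}:U\in\mathrm{U}(3)\}$. $\mathcal{O}_A$ and $L_I$ intersect transversally at $B\in\mathcal{O}_A\cap L_I$ if the sum of $L_I$ and the tangent space of $\mathcal{O}_A$ at $B$ is $L(3)$ (as real vector spaces). $A\in L(3)$ is generic if this holds at all $B\in\mathcal{O}_A\cap L_I$. $\Theta$ is the set of nongeneric matrices in $L(3)$. $P_1:L_I\to\mathbf{R}$ is $$\begin{aligned}P_1(A)=\;&|(v-w)x^2|^2+|(w-u)y^2|^2+|(u-v)z^2|^2\\ &+(|(v-w)x|^2+|yz|^2)(|v|^2+|w|^2-5|u|^2)\\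 &+(|(w-u)y|^2+|zx|^2)(|w|^2+|u|^2-5|v|^2)\\ &+(|(u-v)z|^2+|xy|^2)(|u|^2+|v|^2-5|w|^2)\\ &+|(u-v)(v-w)(w-u)|^2.\end{aligned}$$ Definition of $P$ (a homogeneous real polynomial of degree 24 in the real and imaginary parts of the entries of $X\in L(3)$). For $X\in L(3)$, $Y=X^*$, put $i_1=\mathrm{tr}(XY)$; $i_2=\mathrm{tr}(X^2Y^2)$; $i_3=\frac14|\mathrm{tr}(X^2)|^2$; $i_4=\mathrm{tr}(XYX^2Y^2)$; $i_5=\frac19|\mathrm{tr}(X^3)|^2$; $i_6=|\mathrm{tr}(X^2Y)|^2$; $i_7=\frac16\mathrm{Re}\big(\mathrm{tr}(Y^2)(3\,\mathrm{tr}(X^2Y)^2+\mathrm{tr}(X^3)\mathrm{tr}(XY^2))\big)$; $i_8=\frac16\mathrm{Re}\big(\mathrm{tr}(Y^2)(3\,\mathrm{tr}(X^2Y)^2-\mathrm{tr}(X^3)\mathrm{tr}(XY^2))\big)$; $i_{11}=\frac1{12}\mathrm{Re}(\mathrm{tr}(X^2)^2\mathrm{tr}(Y^3)\mathrm{tr}(XY^2))$; $i_{13}=\frac1{72}\mathrm{Re}(\mathrm{tr}(X^3)^2\mathrm{tr}(Y^2)^3)$; $i_{16}=\frac1{144}\mathrm{Re}(\mathrm{tr}(X^2)^4\mathrm{tr}(Y^3)^2\mathrm{tr}(XY^2)^2)$. Then $P=\sum_{k,l}p_{kl}\,i_3^k i_6^l$, where the nonzero $p_{kl}$ are: $p_{00}=-6\,(126i_2^2i_1^4-26i_2i_1^6+336i_7i_2i_1^2-270i_2^3i_1^2+1536i_7^2+216i_2^4-11i_7i_1^4+2i_1^8-1152i_7i_2^2)(i_8+i_7)$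 $p_{01}=18432i_{11}i_7+186i_8i_1^5+2016i_{11}i_1^2i_2+2160i_2^2i_1i_7-66i_{11}i_1^4+2160i_8i_1i_2^2-1278i_8i_1^3i_2+186i_1^5i_7-6912i_{11}i_2^2+3456i_1i_7^2+3456i_8i_1i_7-1278i_1^3i_2i_7$ $p_{02}=3888i_8i_2+297i_1^2i_2^2-4608i_{13}-324i_2^3-90i_1^4i_2+3888i_2i_7+9i_1^6-1242i_1^2i_7-1242i_8i_1^2-3456i_{11}i_1$ $p_{03}=18i_1(-7i_1^2+27i_2)$ $p_{04}=729$ $p_{10}=6912i_7i_4i_1i_2+2016i_2i_1^2i_{13}-33i_4i_2i_1^5+1008i_4i_2^2i_1^3-3456i_4i_1i_2^3-1008i_4^2i_2i_1^2+31104i_5^2i_2^2+33i_5i_1^7+297i_5^2i_1^4+9792i_2^3i_8-2304i_4^2i_8-251i_1^6i_8-20736i_5^2i_8-3024i_5i_4i_2i_1^2+25920i_7i_2^3-55296i_7^2i_2-6912i_7i_4^2+17760i_7^2i_1^2+3456i_4^2i_2^2+9504i_5i_2^2i_1^3-6912i_7i_5i_1^3-66i_1^4i_{13}+4608i_{16}-24012i_7i_2^2i_1^2-317i_7i_1^6-62208i_7i_5^2+2304i_4i_2i_1i_8-1206i_5i_2i_1^5+3012i_2i_1^4i_8+5226i_7i_2i_1^4-20736i_7i_5i_4+8544i_7i_1^2i_8-6912i_2^2i_{13}+9216i_7i_{13}+66i_1^5i_{11}-9072i_5^2i_2i_1^2-2304i_5i_1^3i_8-27648i_7i_2i_8-6912i_5i_4i_8-11052i_2^2i_1^2i_8+13824i_5i_2i_1i_8+10368i_5i_4i_2^2+1632i_2^2i_1^6-5151i_2^3i_1^4+7200i_2^4i_1^2-256i_2i_1^8+16i_1^{10}-1728i_2^5-2016i_2i_1^3i_{11}+41472i_7i_5i_1i_2-18432i_7i_1i_{11}+6912i_2^2i_1i_{11}-20736i_5i_1i_2^3+99i_5i_4i_1^4+33i_4^2i_1^4$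 $p_{11}=-4320i_5i_2i_1^2+6i_1^3i_8+6912i_7i_4+1728i_4^2i_1-3450i_7i_1^3-5088i_1^2i_{11}+14688i_1i_2^3+2721i_2i_1^5+2304i_4i_8-4320i_2i_1i_8+15552i_5^2i_1+1152i_1i_{13}+11520i_5i_8-3456i_4i_2^2+1440i_7i_1i_2-20736i_5i_2^2-272i_1^7+1530i_5i_1^4-33i_4i_1^4+32256i_2i_{11}+5184i_5i_4i_1-9792i_2^2i_1^3-720i_4i_2i_1^2+39168i_7i_5$ $p_{12}=-1728i_4i_1+2130i_1^4-10170i_2i_1^2+15228i_2^2+1296i_8+1296i_7-10368i_5i_1$ $p_{13}=-3726i_1$ $p_{20}=-4272i_4i_2i_1^3+16128i_4i_1i_2^2-16128i_4^2i_2+12816i_5i_4i_1^2-48384i_5i_4i_2+4272i_4^2i_1^2-27360i_2^2i_8+23808i_7i_8+80844i_7i_2i_1^2+69888i_7^2-47808i_5i_2i_1^3+117504i_5i_1i_2^2-39168i_7i_5i_1+19500i_2i_1^2i_8-8544i_1^2i_{13}+32256i_2i_{13}+8544i_1^3i_{11}+384i_1^8+20160i_2^4-128736i_7i_2^2-11607i_7i_1^4+4470i_5i_1^5-145152i_5^2i_2+38448i_5^2i_1^2-2799i_1^4i_8-11520i_5i_1i_8-50016i_2^3i_1^2-5279i_2i_1^6+26283i_2^2i_1^4-32256i_2i_1i_{11}$ $p_{21}=-22224i_7i_1-4272i_4i_1^2-37632i_{11}+16128i_4i_2+96768i_5i_2-2112i_1^5+18192i_2i_1^3-15264i_5i_1^2-8400i_1i_8-40608i_1i_2^2$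 $p_{22}=-10476i_2+10401i_1^2$ $p_{30}=44448i_5i_1^3+31296i_8i_2+4415i_1^6-76308i_1^2i_7-18816i_4i_1i_2+169344i_5^2+56448i_5i_4+128496i_1^2i_2^2+37632i_{11}i_1-209664i_5i_1i_2+18816i_4^2-9108i_8i_1^2+236352i_2i_7-37632i_{13}-90624i_2^3-43032i_1^4i_2$ $p_{31}=-117504i_5+480i_2i_1+3312i_1^3-18816i_4$ $p_{32}=-5196$ $p_{40}=-146816i_2i_1^2-10384i_8+112896i_5i_1+23948i_1^4+195840i_2^2-142480i_7$ $p_{41}=33632i_1$ $p_{50}=-202048i_2+65232i_1^2$ $p_{60}=78400$ *)

(* Defs.v *)
(* Importing mpoly after topology fails (incompatible notation levels). *)
From HB Require Import structures.
From mathcomp Require Import all_boot all_order all_algebra.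
From mathcomp Require Import spectral complex mpoly.
From mathcomp Require Import boolp classical_sets reals topology normedtype
  derive.

Set Implicit Arguments.
Unset Strict Implicit.
Unset Printing Implicit Defensive.

Import Order.TTheory GRing.Theory Num.Theory.
Import numFieldNormedType.Exports.

(* Literals above 5000 are kept as [Nat.of_num_uint _], on purpose. *)
Set Warnings "-abstract-large-number".

Local Open Scope classical_set_scope.
Local Open Scope complex_scope.
Local Open Scope sesquilinear_scope.
Local Open Scope ring_scope.

(* The row and column indices 1, 2, 3 of the usual numbering from 1. *)
Definition e1 : 'I_3 := @Ordinal 3 0 isT.
Definition e2 : 'I_3 := @Ordinal 3 1 isT.
Definition e3 : 'I_3 := @Ordinal 3 2 isT.

Definition L3 (R : realType) : set 'M[R[i]]_3 := [set A | \tr A = 0].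
Arguments L3 R : clear implicits.

Definition LI (R : realType) : set 'M[R[i]]_3 :=
  [set A | [/\ L3 R A, A e1 e3 = 0, A e2 e1 = 0 & A e3 e2 = 0]].
Arguments LI R : clear implicits.

Definition unitary_orbit (R : realType) (A : 'M[R[i]]_3) : set 'M[R[i]]_3 :=
  [set U *m A *m invmx U | U in [set U : 'M[R[i]]_3 | U \is unitarymx]].

Definition smooth (R : realType) (f : R -> R) : Prop :=
  forall (n : nat) (t : R), derivable (derive1n n f) t 1.

Definition smooth_curve (R : realType) (g : R -> 'M[R[i]]_3) : Prop :=
  forall j k : 'I_3, smooth (fun t => complex.Re (g t j k)) /\
                     smooth (fun t => complex.Im (g t j k)).

Definition velocity (R : realType) (g : R -> 'M[R[i]]_3) (t : R) :
    'M[R[i]]_3 :=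
  \matrix_(j, k) (derive1 (fun s => complex.Re (g s j k)) t +i*
                  derive1 (fun s => complex.Im (g s j k)) t).

(* Velocities at B of the smooth curves in S passing through B.  This is the
   tangent space at B when S is an embedded submanifold, as is any orbit of
   the compact group U(3). *)
Definition tangent_space (R : realType) (S : set 'M[R[i]]_3)
    (B : 'M[R[i]]_3) : set 'M[R[i]]_3 :=
  [set V | exists g : R -> 'M[R[i]]_3,
     [/\ smooth_curve g, forall t, S (g t), g 0 = B & velocity g 0 = V]].

Definition transversal_at (R : realType) (A B : 'M[R[i]]_3) : Prop :=
  [set M | exists N V : 'M[R[i]]_3,
     [/\ LI R N, tangent_space (unitary_orbit A) B V & M = N + V]] = L3 R.

Definition generic (R : realType) (A : 'M[R[i]]_3) : Prop :=
  forall B, (unitary_orbit A `&` LI R) B -> transversal_at A B.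

Definition Theta (R : realType) : set 'M[R[i]]_3 :=
  [set A | L3 R A /\ ~ generic A].
Arguments Theta R : clear implicits.

Definition abs2 (R : realType) (z : R[i]) : R := ComplexField.Normc.normc z ^+ 2.

Definition P1 (R : realType) (A : 'M[R[i]]_3) : R :=
  let u := A e1 e1 in let v := A e2 e2 in let w := A e3 e3 in
  let x := A e2 e3 in let y := A e3 e1 in let z := A e1 e2 in
  abs2 ((v - w) * x ^+ 2) + abs2 ((w - u) * y ^+ 2) + abs2 ((u - v) * z ^+ 2)
  + (abs2 ((v - w) * x) + abs2 (y * z)) * (abs2 v + abs2 w - 5%:R * abs2 u)
  + (abs2 ((w - u) * y) + abs2 (z * x)) * (abs2 w + abs2 u - 5%:R * abs2 v)
  + (abs2 ((u - v) * z) + abs2 (x * y)) * (abs2 u + abs2 v - 5%:R * abs2 w)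
  + abs2 ((u - v) * (v - w) * (w - u)).

(* [P_coef i1 i2 i4 i5 i7 i8 i11 i13 i16 k l] is the coefficient p_kl. *)
Definition P_coef (R : realType) (i1 i2 i4 i5 i7 i8 i11 i13 i16 : R)
    (k l : nat) : R :=
  match k, l with
  | 0, 0 =>
      - 6%:R * (126%:R * i2 ^+ 2 * i1 ^+ 4 - 26%:R * i2 * i1 ^+ 6 + 336%:R *
      i7 * i2 * i1 ^+ 2 - 270%:R * i2 ^+ 3 * i1 ^+ 2 + 1536%:R * i7 ^+ 2 +
      216%:R * i2 ^+ 4 - 11%:R * i7 * i1 ^+ 4 + 2%:R * i1 ^+ 8 - 1152%:R *
      i7 * i2 ^+ 2) * (i8 + i7)
  | 0, 1 =>
      18432%:R * i11 * i7 + 186%:R * i8 * i1 ^+ 5 + 2016%:R * i11 * i1 ^+ 2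
      * i2 + 2160%:R * i2 ^+ 2 * i1 * i7 - 66%:R * i11 * i1 ^+ 4 + 2160%:R *
      i8 * i1 * i2 ^+ 2 - 1278%:R * i8 * i1 ^+ 3 * i2 + 186%:R * i1 ^+ 5 *
      i7 - 6912%:R * i11 * i2 ^+ 2 + 3456%:R * i1 * i7 ^+ 2 + 3456%:R * i8 *
      i1 * i7 - 1278%:R * i1 ^+ 3 * i2 * i7
  | 0, 2 =>
      3888%:R * i8 * i2 + 297%:R * i1 ^+ 2 * i2 ^+ 2 - 4608%:R * i13 -
      324%:R * i2 ^+ 3 - 90%:R * i1 ^+ 4 * i2 + 3888%:R * i2 * i7 + 9%:R *
      i1 ^+ 6 - 1242%:R * i1 ^+ 2 * i7 - 1242%:R * i8 * i1 ^+ 2 - 3456%:R *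
      i11 * i1
  | 0, 3 =>
      18%:R * i1 * (- 7%:R * i1 ^+ 2 + 27%:R * i2)
  | 0, 4 =>
      729%:R
  | 1, 0 =>
      6912%:R * i7 * i4 * i1 * i2 + 2016%:R * i2 * i1 ^+ 2 * i13 - 33%:R *
      i4 * i2 * i1 ^+ 5 + 1008%:R * i4 * i2 ^+ 2 * i1 ^+ 3 - 3456%:R * i4 *
      i1 * i2 ^+ 3 - 1008%:R * i4 ^+ 2 * i2 * i1 ^+ 2 + 31104%:R * i5 ^+ 2 *
      i2 ^+ 2 + 33%:R * i5 * i1 ^+ 7 + 297%:R * i5 ^+ 2 * i1 ^+ 4 + 9792%:R
      * i2 ^+ 3 * i8 - 2304%:R * i4 ^+ 2 * i8 - 251%:R * i1 ^+ 6 * i8 -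
      20736%:R * i5 ^+ 2 * i8 - 3024%:R * i5 * i4 * i2 * i1 ^+ 2 + 25920%:R
      * i7 * i2 ^+ 3 - 55296%:R * i7 ^+ 2 * i2 - 6912%:R * i7 * i4 ^+ 2 +
      17760%:R * i7 ^+ 2 * i1 ^+ 2 + 3456%:R * i4 ^+ 2 * i2 ^+ 2 + 9504%:R *
      i5 * i2 ^+ 2 * i1 ^+ 3 - 6912%:R * i7 * i5 * i1 ^+ 3 - 66%:R * i1 ^+ 4
      * i13 + 4608%:R * i16 - 24012%:R * i7 * i2 ^+ 2 * i1 ^+ 2 - 317%:R *
      i7 * i1 ^+ 6 - 62208%:R * i7 * i5 ^+ 2 + 2304%:R * i4 * i2 * i1 * i8 -
      1206%:R * i5 * i2 * i1 ^+ 5 + 3012%:R * i2 * i1 ^+ 4 * i8 + 5226%:R *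
      i7 * i2 * i1 ^+ 4 - 20736%:R * i7 * i5 * i4 + 8544%:R * i7 * i1 ^+ 2 *
      i8 - 6912%:R * i2 ^+ 2 * i13 + 9216%:R * i7 * i13 + 66%:R * i1 ^+ 5 *
      i11 - 9072%:R * i5 ^+ 2 * i2 * i1 ^+ 2 - 2304%:R * i5 * i1 ^+ 3 * i8 -
      27648%:R * i7 * i2 * i8 - 6912%:R * i5 * i4 * i8 - 11052%:R * i2 ^+ 2
      * i1 ^+ 2 * i8 + 13824%:R * i5 * i2 * i1 * i8 + 10368%:R * i5 * i4 *
      i2 ^+ 2 + 1632%:R * i2 ^+ 2 * i1 ^+ 6 - 5151%:R * i2 ^+ 3 * i1 ^+ 4 +
      7200%:R * i2 ^+ 4 * i1 ^+ 2 - 256%:R * i2 * i1 ^+ 8 + 16%:R * i1 ^+ 10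
      - 1728%:R * i2 ^+ 5 - 2016%:R * i2 * i1 ^+ 3 * i11 + 41472%:R * i7 *
      i5 * i1 * i2 - 18432%:R * i7 * i1 * i11 + 6912%:R * i2 ^+ 2 * i1 * i11
      - 20736%:R * i5 * i1 * i2 ^+ 3 + 99%:R * i5 * i4 * i1 ^+ 4 + 33%:R *
      i4 ^+ 2 * i1 ^+ 4
  | 1, 1 =>
      - 4320%:R * i5 * i2 * i1 ^+ 2 + 6%:R * i1 ^+ 3 * i8 + 6912%:R * i7 *
      i4 + 1728%:R * i4 ^+ 2 * i1 - 3450%:R * i7 * i1 ^+ 3 - 5088%:R * i1 ^+
      2 * i11 + 14688%:R * i1 * i2 ^+ 3 + 2721%:R * i2 * i1 ^+ 5 + 2304%:R *
      i4 * i8 - 4320%:R * i2 * i1 * i8 + 15552%:R * i5 ^+ 2 * i1 + 1152%:R *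
      i1 * i13 + 11520%:R * i5 * i8 - 3456%:R * i4 * i2 ^+ 2 + 1440%:R * i7
      * i1 * i2 - 20736%:R * i5 * i2 ^+ 2 - 272%:R * i1 ^+ 7 + 1530%:R * i5
      * i1 ^+ 4 - 33%:R * i4 * i1 ^+ 4 + 32256%:R * i2 * i11 + 5184%:R * i5
      * i4 * i1 - 9792%:R * i2 ^+ 2 * i1 ^+ 3 - 720%:R * i4 * i2 * i1 ^+ 2 +
      39168%:R * i7 * i5
  | 1, 2 =>
      - 1728%:R * i4 * i1 + 2130%:R * i1 ^+ 4 - 10170%:R * i2 * i1 ^+ 2 +
      15228%:R * i2 ^+ 2 + 1296%:R * i8 + 1296%:R * i7 - 10368%:R * i5 * i1
  | 1, 3 =>
      - 3726%:R * i1
  | 2, 0 =>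
      - 4272%:R * i4 * i2 * i1 ^+ 3 + 16128%:R * i4 * i1 * i2 ^+ 2 -
      16128%:R * i4 ^+ 2 * i2 + 12816%:R * i5 * i4 * i1 ^+ 2 - 48384%:R * i5
      * i4 * i2 + 4272%:R * i4 ^+ 2 * i1 ^+ 2 - 27360%:R * i2 ^+ 2 * i8 +
      23808%:R * i7 * i8 + 80844%:R * i7 * i2 * i1 ^+ 2 + 69888%:R * i7 ^+ 2
      - 47808%:R * i5 * i2 * i1 ^+ 3 + 117504%:R * i5 * i1 * i2 ^+ 2 -
      39168%:R * i7 * i5 * i1 + 19500%:R * i2 * i1 ^+ 2 * i8 - 8544%:R * i1
      ^+ 2 * i13 + 32256%:R * i2 * i13 + 8544%:R * i1 ^+ 3 * i11 + 384%:R *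
      i1 ^+ 8 + 20160%:R * i2 ^+ 4 - 128736%:R * i7 * i2 ^+ 2 - 11607%:R *
      i7 * i1 ^+ 4 + 4470%:R * i5 * i1 ^+ 5 - 145152%:R * i5 ^+ 2 * i2 +
      38448%:R * i5 ^+ 2 * i1 ^+ 2 - 2799%:R * i1 ^+ 4 * i8 - 11520%:R * i5
      * i1 * i8 - 50016%:R * i2 ^+ 3 * i1 ^+ 2 - 5279%:R * i2 * i1 ^+ 6 +
      26283%:R * i2 ^+ 2 * i1 ^+ 4 - 32256%:R * i2 * i1 * i11
  | 2, 1 =>
      - 22224%:R * i7 * i1 - 4272%:R * i4 * i1 ^+ 2 - 37632%:R * i11 +
      16128%:R * i4 * i2 + 96768%:R * i5 * i2 - 2112%:R * i1 ^+ 5 + 18192%:R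
      * i2 * i1 ^+ 3 - 15264%:R * i5 * i1 ^+ 2 - 8400%:R * i1 * i8 -
      40608%:R * i1 * i2 ^+ 2
  | 2, 2 =>
      - 10476%:R * i2 + 10401%:R * i1 ^+ 2
  | 3, 0 =>
      44448%:R * i5 * i1 ^+ 3 + 31296%:R * i8 * i2 + 4415%:R * i1 ^+ 6 -
      76308%:R * i1 ^+ 2 * i7 - 18816%:R * i4 * i1 * i2 + 169344%:R * i5 ^+
      2 + 56448%:R * i5 * i4 + 128496%:R * i1 ^+ 2 * i2 ^+ 2 + 37632%:R *
      i11 * i1 - 209664%:R * i5 * i1 * i2 + 18816%:R * i4 ^+ 2 - 9108%:R *
      i8 * i1 ^+ 2 + 236352%:R * i2 * i7 - 37632%:R * i13 - 90624%:R * i2 ^+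
      3 - 43032%:R * i1 ^+ 4 * i2
  | 3, 1 =>
      - 117504%:R * i5 + 480%:R * i2 * i1 + 3312%:R * i1 ^+ 3 - 18816%:R *
      i4
  | 3, 2 =>
      - 5196%:R
  | 4, 0 =>
      - 146816%:R * i2 * i1 ^+ 2 - 10384%:R * i8 + 112896%:R * i5 * i1 +
      23948%:R * i1 ^+ 4 + 195840%:R * i2 ^+ 2 - 142480%:R * i7
  | 4, 1 =>
      33632%:R * i1
  | 5, 0 =>
      - 202048%:R * i2 + 65232%:R * i1 ^+ 2
  | 6, 0 =>
      78400%:R
  | _, _ => 0
  end.

Lemma Im_tr_eq0 (R : realType) (M : 'M[R[i]]_3) :
  \tr (M^t*) = \tr M -> complex.Im (\tr M) = 0.
Proof.
rewrite trace_map_mx mxtrace_tr.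
by case: (\tr M) => a b [] /eqP; rewrite eq_sym -addr_eq0 -mulr2n mulrn_eq0
  => /eqP.
Qed.

Lemma trace_inv_real (R : realType) (X : 'M[R[i]]_3) :
  let Y := X^t* in
  [/\ complex.Im (\tr (X *m Y)) = 0,
      complex.Im (\tr (X *m X *m (Y *m Y))) = 0
    & complex.Im (\tr (X *m Y *m (X *m X) *m (Y *m Y))) = 0].
Proof.
move=> Y; have YK : Y^t* = X by apply/matrixP => j k; rewrite !mxE conjCK.
have XK : X^t* = Y by [].
clearbody Y.
have adjM (A B : 'M[R[i]]_3) : (A *m B)^t* = B^t* *m A^t*.
  by rewrite trmx_mul map_mxM.
split; apply: Im_tr_eq0; rewrite !adjM !XK !YK.
- exact: erefl.
- exact: erefl.
rewrite mulmxA mxtrace_mulC !mulmxA.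
exact: erefl.
Qed.

(* The traces tr(X Y), tr(X^2 Y^2) and tr(X Y X^2 Y^2) are real (see
   [trace_inv_real]), so that taking real parts only changes their type. *)
Definition P (R : realType) (X : 'M[R[i]]_3) : R :=
  let Y := X^t* in
  let X2 := X *m X in let X3 := X2 *m X in
  let Y2 := Y *m Y in let Y3 := Y2 *m Y in
  let trX2 := \tr X2 in let trX3 := \tr X3 in
  let trY2 := \tr Y2 in let trY3 := \tr Y3 in
  let trX2Y := \tr (X2 *m Y) in let trXY2 := \tr (X *m Y2) in
  let i1 := complex.Re (\tr (X *m Y)) in
  let i2 := complex.Re (\tr (X2 *m Y2)) in
  let i3 := 4%:R^-1 * abs2 trX2 in
  let i4 := complex.Re (\tr (X *m Y *m X2 *m Y2)) in
  let i5 := 9%:R^-1 * abs2 trX3 in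
  let i6 := abs2 trX2Y in
  let i7 := 6%:R^-1 *
    complex.Re (trY2 * (3%:R * trX2Y ^+ 2 + trX3 * trXY2)) in
  let i8 := 6%:R^-1 *
    complex.Re (trY2 * (3%:R * trX2Y ^+ 2 - trX3 * trXY2)) in
  let i11 := 12%:R^-1 * complex.Re (trX2 ^+ 2 * trY3 * trXY2) in
  let i13 := 72%:R^-1 * complex.Re (trX3 ^+ 2 * trY2 ^+ 3) in
  let i16 := 144%:R^-1 *
    complex.Re (trX2 ^+ 4 * trY3 ^+ 2 * trXY2 ^+ 2) in
  \sum_(k < 7) \sum_(l < 5)
    P_coef i1 i2 i4 i5 i7 i8 i11 i13 i16 k l * i3 ^+ k * i6 ^+ l.

Definition Gamma (R : realType) : set 'M[R[i]]_3 :=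
  [set X | L3 R X /\ P X = 0].
Arguments Gamma R : clear implicits.

Definition real_coords (R : realType) (A : 'M[R[i]]_3) (j : 'I_10) : R :=
  let u := A e1 e1 in let v := A e2 e2 in
  let x := A e2 e3 in let y := A e3 e1 in let z := A e1 e2 in
  nth 0 [:: complex.Re x; complex.Im x; complex.Re y; complex.Im y;
            complex.Re z; complex.Im z; complex.Re u; complex.Im u;
            complex.Re v; complex.Im v] j.

Definition eval_LI (R : realType) (Q : {mpoly int[10]}) (A : 'M[R[i]]_3) : R :=
  (map_mpoly intr Q).@[real_coords A].

(* Main.v *)
(** On [L_I] the trace invariants depend on [x], [y], [z] only through
    [|x|^2], [|y|^2], [|z|^2] and [xyz].  In the Fourier coordinates
    [u = A + B], [v = om A + om^2 B], [w = om^2 A + om B] over Z/3 (with the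
    analogous ones for the squared moduli) all of them become sparse, [i4]
    enters [P] only through [i4 (i1 i2 - 3 i5 + i6 - i4)], and [P = P1^2 P2] is
    a small polynomial identity.  The cofactor [P2] depends on the squared
    moduli of the entries only: it is, up to the factor -1/3, the discriminant
    of a cubic polynomial.

    For a skew-Hermitian [K] with off-diagonal part [k], the entries of
    [[K, B]] at the positions of [I] are those of [- (n x k + D k^* )], where
    [n = (x, y, z)] and [D = diag (v - w, w - u, u - v)].  The determinant of
    this real-linear map of [k] is [- P1 B], so [O_A] and [L_I] meet
    transversally at [B] as soon as [P1 B != 0].  Hence a nongeneric [A] has in
    its orbit some [B] of [L_I] with [P1 B = 0], and [P A = P B = 0] because [P]
    is unitarily invariant. *)

Require Import Defs.
From HB Require Import structures.
From mathcomp Require Import all_boot all_order all_algebra.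
From mathcomp Require Import spectral complex mpoly.
From mathcomp Require Import boolp classical_sets reals topology normedtype
  derive.
From mathcomp Require Import trigo ring.

Set Warnings "-abstract-large-number".
Set Implicit Arguments.
Unset Strict Implicit.
Unset Printing Implicit Defensive.

Import Order.TTheory GRing.Theory Num.Theory.
Import numFieldNormedType.Exports.

Local Open Scope classical_set_scope.
Local Open Scope ring_scope.

(** * The factorization in Fourier coordinates *)

(* [P] in terms of the invariants below and of [G = i7 + i8], [H = i7 - i8],
   [L = 2 i11], [M = 2 i13] and [Q = i4 (i1 i2 - 3 i5 + i6 - i4)]. *)
Definition P_quad (K : comPzRingType) (i1 i2 i3 i6 G H : K) : K :=
  i3 * (33 * i1 ^+ 4 + i2 * (-1008%:R * i1 ^+ 2 + 3456%:R * i2) + i3 *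
  (4272%:R * i1 ^+ 2 + i2 * (-16128%:R) + 18816%:R * i3)) + 1728%:R * i1 * i3
  * i6 + G * (-4608%:R * i3) + H * (-2304%:R * i3).

Definition P_reduced (K : comPzRingType) (i1 i2 i3 i5 i6 G H L M Q : K) : K :=
  i3 * (16 * i1 ^+ 10 + i2 * (-256 * i1 ^+ 8 + i2 * (1632%:R * i1 ^+ 6 + i2 *
  (-5151%:R * i1 ^+ 4 + i2 * (7200%:R * i1 ^+ 2 + i2 * (-1728%:R))))) + i3 *
  (384 * i1 ^+ 8 + i2 * (-5279%:R * i1 ^+ 6 + i2 * (26283%:R * i1 ^+ 4 + i2 *
  (-50016%:R * i1 ^+ 2 + 20160%:R * i2))) + i3 * (4415%:R * i1 ^+ 6 + i2 *
  (-43032%:R * i1 ^+ 4 + i2 * (128496%:R * i1 ^+ 2 + i2 * (-90624%:R))) + i3 *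
  (23948%:R * i1 ^+ 4 + i2 * (-146816%:R * i1 ^+ 2 + 195840%:R * i2) + i3 *
  (65232%:R * i1 ^+ 2 + i2 * (-202048%:R) + 78400%:R * i3))))) + i6 * (i3 *
  (-272 * i1 ^+ 7 + i2 * (2721%:R * i1 ^+ 5 + i2 * (-9792%:R * i1 ^+ 3 +
  14688%:R * i1 * i2)) + i3 * (-2112%:R * i1 ^+ 5 + i2 * (18192%:R * i1 ^+ 3 +
  i2 * (-40608%:R * i1)) + i3 * (3312%:R * i1 ^+ 3 + 480 * i1 * i2 + 33632%:R
  * i1 * i3))) + i6 * (9 * i1 ^+ 6 + i2 * (-90 * i1 ^+ 4 + i2 * (297 * i1 ^+ 2
  + i2 * (-324))) + i3 * (2130%:R * i1 ^+ 4 + i2 * (-10170%:R * i1 ^+ 2 +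
  15228%:R * i2) + i3 * (10401%:R * i1 ^+ 2 + i2 * (-10476%:R) + i3 *
  (-5196%:R))) + i6 * (-126 * i1 ^+ 3 + 486 * i1 * i2 + i3 * (-3726%:R * i1) +
  729 * i6))) + i5 * (i3 * (33 * i1 ^+ 7 + i2 * (-1206%:R * i1 ^+ 5 + i2 *
  (9504%:R * i1 ^+ 3 + i2 * (-20736%:R * i1))) + i3 * (4470%:R * i1 ^+ 5 + i2
  * (-47808%:R * i1 ^+ 3 + 117504%:R * i1 * i2) + i3 * (44448%:R * i1 ^+ 3 +
  i2 * (-209664%:R * i1) + 112896%:R * i1 * i3))) + i6 * (i3 * (1530%:R * i1
  ^+ 4 + i2 * (-4320%:R * i1 ^+ 2 + i2 * (-20736%:R)) + i3 * (-15264%:R * i1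
  ^+ 2 + 96768%:R * i2 + i3 * (-122112%:R))) + i6 * (-10368%:R * i1 * i3)) +
  i5 * (i3 * (297 * i1 ^+ 4 + i2 * (-9072%:R * i1 ^+ 2 + 31104%:R * i2) + i3 *
  (38448%:R * i1 ^+ 2 + i2 * (-145152%:R) + 169344%:R * i3)) + 15552%:R * i1 *
  i3 * i6)) + G * (-12 * i1 ^+ 8 + i2 * (156 * i1 ^+ 6 + i2 * (-756 * i1 ^+ 4
  + i2 * (1620%:R * i1 ^+ 2 + i2 * (-1296%:R)))) + i3 * (-284 * i1 ^+ 6 + i2 *
  (4119%:R * i1 ^+ 4 + i2 * (-17532%:R * i1 ^+ 2 + 17856%:R * i2)) + i3 *
  (-7203%:R * i1 ^+ 4 + i2 * (50172%:R * i1 ^+ 2 + i2 * (-78048%:R)) + i3 *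
  (-42708%:R * i1 ^+ 2 + 133824%:R * i2 + i3 * (-76432%:R)))) + i6 * (186 * i1
  ^+ 5 + i2 * (-1278%:R * i1 ^+ 3 + 2160%:R * i1 * i2) + i3 * (-1722%:R * i1
  ^+ 3 + i2 * (-1440%:R * i1) + i3 * (-15312%:R * i1)) + i6 * (-1242%:R * i1
  ^+ 2 + 3888%:R * i2 + 1296%:R * i3)) + i5 * (i3 * (-4608%:R * i1 ^+ 3 +
  27648%:R * i1 * i2 + i3 * (-25344%:R * i1)) + 25344%:R * i3 * i6 + i5 *
  (-41472%:R * i3)) + G * (33 * i1 ^+ 4 + i2 * (-1008%:R * i1 ^+ 2 + 3456%:R *
  i2) + i3 * (6576%:R * i1 ^+ 2 + i2 * (-20736%:R) + 23424%:R * i3) + 1728%:R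
  * i1 * i6 + G * (-2304%:R))) + H * (i3 * (-33 * i1 ^+ 6 + i2 * (1107%:R * i1
  ^+ 4 + i2 * (-6480%:R * i1 ^+ 2 + 8064%:R * i2)) + i3 * (-4404%:R * i1 ^+ 4
  + i2 * (30672%:R * i1 ^+ 2 + i2 * (-50688%:R)) + i3 * (-33600%:R * i1 ^+ 2 +
  102528%:R * i2 + i3 * (-66048%:R)))) + i6 * (i3 * (-1728%:R * i1 ^+ 3 +
  2880%:R * i1 * i2 + i3 * (-6912%:R * i1))) + i5 * (i3 * (-2304%:R * i1 ^+ 3
  + 13824%:R * i1 * i2 + i3 * (-13824%:R * i1)) + 13824%:R * i3 * i6 + i5 *
  (-20736%:R * i3)) + G * (33 * i1 ^+ 4 + i2 * (-1008%:R * i1 ^+ 2 + 3456%:R *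
  i2) + i3 * (8880%:R * i1 ^+ 2 + i2 * (-27648%:R) + 34944%:R * i3) + 1728%:R
  * i1 * i6 + G * (-4608%:R)) + H * (i3 * (2304%:R * i1 ^+ 2 + i2 * (-6912%:R)
  + 11520%:R * i3) + G * (-2304%:R))) + L * (i3 * (33 * i1 ^+ 5 + i2 *
  (-1008%:R * i1 ^+ 3 + 3456%:R * i1 * i2) + i3 * (4272%:R * i1 ^+ 3 + i2 *
  (-16128%:R * i1) + 18816%:R * i1 * i3)) + i6 * (-33 * i1 ^+ 4 + i2 *
  (1008%:R * i1 ^+ 2 + i2 * (-3456%:R)) + i3 * (-2544%:R * i1 ^+ 2 + 16128%:R
  * i2 + i3 * (-18816%:R)) + i6 * (-1728%:R * i1)) + G * (-4608%:R * i1 * i3 +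
  4608%:R * i6) + H * (-4608%:R * i1 * i3 + 4608%:R * i6) + 2304%:R * i3 * L)
  + M * (i3 * (-33 * i1 ^+ 4 + i2 * (1008%:R * i1 ^+ 2 + i2 * (-3456%:R)) + i3
  * (-4272%:R * i1 ^+ 2 + 16128%:R * i2 + i3 * (-18816%:R))) + i6 * (576 * i1
  * i3 + i6 * (-2304%:R)) + 2304%:R * i3 * G + 2304%:R * i3 * H)
  - P_quad i1 i2 i3 i6 G H * Q.

(* The polarization of [P1]: primed letters stand for complex conjugates, and
   [a], [b], [c] for the squared moduli of [x], [y], [z]. *)
Definition P1_form (K : comPzRingType) (a b c u v w u' v' w' : K) : K :=
  (v - w) * (v' - w') * a ^+ 2 + (w - u) * (w' - u') * b ^+ 2
  + (u - v) * (u' - v') * c ^+ 2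
  + ((v - w) * (v' - w') * a + b * c) * (v * v' + w * w' - 5 * (u * u'))
  + ((w - u) * (w' - u') * b + c * a) * (w * w' + u * u' - 5 * (v * v'))
  + ((u - v) * (u' - v') * c + a * b) * (u * u' + v * v' - 5 * (w * w'))
  + (u - v) * (v - w) * (w - u) * ((u' - v') * (v' - w') * (w' - u')).

(* The discriminant of [Y^3 + k Y^2 + (k^2 + 3 m) Y + 3 n] is
   [- 3 * cubic_form k m n]. *)
Definition cubic_form (K : comPzRingType) (k m n : K) : K :=
  (k ^+ 2 + 3 * m) ^+ 2 * (k ^+ 2 + 4 * m) - 14 * k ^+ 3 * n
  - 54 * k * m * n + 81 * n ^+ 2.

(** [a], [b], [c] and [U], [V], [W] stand for the squared moduli of [x], [y], [z] and of [u], [v],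
    [w]. The ring is arbitrary because the form is read in integer polynomials, in [R] and in
    [R[i]]. *)
Definition P2_form (K : comPzRingType) (a b c U V W : K) : K :=
  cubic_form (a + b + c + 3 * (U + V + W))
    (- (a * b + b * c + c * a + a * (2 * U + V + W) + b * (U + 2 * V + W)
        + c * (U + V + 2 * W)
        + 3 * (U ^+ 2 + V ^+ 2 + W ^+ 2 + U * V + V * W + W * U)))
    (a ^+ 2 * U + b ^+ 2 * V + c ^+ 2 * W
     + a * b * (W - U - V) + b * c * (U - V - W) + c * a * (V - W - U)
     + 3 * (a * U * (V + W - U) + b * V * (W + U - V) + c * W * (U + V - W))
     + 9 * U * V * W).

(** The hypothesis on [q * q'] says that it is the product of the three squared moduli, a circulant
    determinant in [e], [f], [f']. The last factor is -243 times the discriminant of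
    [T^3 + e T^2 + c2 T + c3]. No root of unity is left in the formulas, and the factors 4 avoid
    halving in a general ring. *)
Lemma P_reduced_fourier (K : comPzRingType) (A B A' B' e f f' q q' : K) :
  q * q' = e ^+ 3 + f ^+ 3 + f' ^+ 3 - 3 * e * f * f' ->
  let i1 := 3 * (A * A' + B * B' + e) in
  let i2 := 3 * ((A * A') ^+ 2 + 4 * A * B * A' * B' + (B * B') ^+ 2
    + (A * A' + B * B') * e + A * B' * f + B * A' * f' + e ^+ 2 - f * f') in
  let p := - 3 * A * B in let p' := - 3 * A' * B' in
  let t := A ^+ 3 + B ^+ 3 + q in let t' := A' ^+ 3 + B' ^+ 3 + q' in
  let s := 3 * (A ^+ 2 * B' + B ^+ 2 * A' - A * f' - B * f) in
  let s' := 3 * (A' ^+ 2 * B + B' ^+ 2 * A - A' * f - B' * f') in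
  let i3 := p * p' in let i5 := t * t' in let i6 := s * s' in
  let S := i1 * i2 - 3 * i5 + i6 in
  let r := 3 * ((A ^+ 3 - B ^+ 3) * q' - (A' ^+ 3 - B' ^+ 3) * q
    - 3 * A * B' * (e * f - f' ^+ 2) + 3 * B * A' * (e * f' - f ^+ 2)
    + f ^+ 3 - f' ^+ 3) in
  let P1 := 27 * ((A ^+ 3 - B ^+ 3) * (A' ^+ 3 - B' ^+ 3)
    - ((A * A') ^+ 2 + (B * B') ^+ 2 - 2 * A * B * A' * B') * e
    + (2 * (B * A') ^+ 2 - A * B' * (A * A' + B * B')) * f
    + (2 * (A * B') ^+ 2 - B * A' * (A * A' + B * B')) * f'
    + (A * A' + B * B') * f * f' - A * B' * f' ^+ 2 - B * A' * f ^+ 2) in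
  let z := A * B' in let z' := B * A' in
  let c2 := f * f' - 3 * z * z' - z * f - z' * f' in
  let c3 := z * (z - f') ^+ 2 + z' * (z' - f) ^+ 2 - 4 * e * z * z' in
  forall Q, 4 * Q = S ^+ 2 + 3 * r ^+ 2 ->
  4 * P_reduced i1 i2 i3 i5 i6 (- (p' * s ^+ 2 + p * s' ^+ 2))
    (- (p' * t * s' + p * t' * s)) (p ^+ 2 * t' * s' + p' ^+ 2 * t * s)
    (- (t ^+ 2 * p' ^+ 3 + t' ^+ 2 * p ^+ 3)) Q
  = 4 * (P1 ^+ 2 * (243 * (27 * c3 ^+ 2 + 4 * c2 ^+ 3 - e ^+ 2 * c2 ^+ 2
                           + 4 * e ^+ 3 * c3 - 18 * e * c2 * c3))).
Proof.
move=> Hq; cbv zeta => Q HQ; rewrite /P_reduced mulrBr [4 * (_ * Q)]mulrCA HQ.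
by rewrite /P_quad; ring: Hq.
Qed.

(** Reduction to Fourier coordinates, by inverting 3 and using a primitive cube root of unity [om].
    Primed letters will become complex conjugates; here they are independent, so that every step is
    a polynomial identity. *)
Lemma P_reduced_factor (K : fieldType) (om a b c q u v w q' u' v' w' : K) :
  let i1 := u * u' + v * v' + w * w' + a + b + c in
  let i2 := (u * u') ^+ 2 + (v * v') ^+ 2 + (w * w') ^+ 2
    + a * (u * u') + b * (v * v') + c * (w * w') + a * b + b * c + c * a in
  let i4 := (u * u') ^+ 3 + (v * v') ^+ 3 + (w * w') ^+ 3
    + (u * u' + c) * (w * w' * c + a * c) + (u * u') ^+ 2 * c
    + (v * v' + a) * (u * u' * a + a * b) + (v * v') ^+ 2 * a
    + (w * w' + b) * (v * v' * b + b * c) + (w * w') ^+ 2 * b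
    + (q * u' ^+ 2 * v' - c * v * v' * v * w' - a * c * u * v')
    + (q * v' ^+ 2 * w' - a * w * w' * w * u' - b * a * v * w')
    + (q * w' ^+ 2 * u' - b * u * u' * u * v' - c * b * w * u')
    + (q' * u ^+ 2 * v - c * v' * v * v' * w - a * c * u' * v)
    + (q' * v ^+ 2 * w - a * w' * w * w' * u - b * a * v' * w)
    + (q' * w ^+ 2 * u - b * u' * u * u' * v - c * b * w' * u) in
  let p := u * v + v * w + w * u in let p' := u' * v' + v' * w' + w' * u' in
  let t := u * v * w + q in let t' := u' * v' * w' + q' in
  let s := u ^+ 2 * u' + v ^+ 2 * v' + w ^+ 2 * w' - (a * u + b * v + c * w) in
  let s' :=
    u * u' ^+ 2 + v * v' ^+ 2 + w * w' ^+ 2 - (a * u' + b * v' + c * w') in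
  2 != 0 :> K -> 3 != 0 :> K -> om ^+ 2 = - om - 1 -> q * q' = a * b * c ->
  u + v + w = 0 -> u' + v' + w' = 0 ->
  P_reduced i1 i2 (p * p') (t * t') (s * s')
    (- (p' * s ^+ 2 + p * s' ^+ 2)) (- (p' * t * s' + p * t' * s))
    (p ^+ 2 * t' * s' + p' ^+ 2 * t * s)
    (- (t ^+ 2 * p' ^+ 3 + t' ^+ 2 * p ^+ 3))
    (i4 * (i1 * i2 - 3 * (t * t') + s * s' - i4))
  = P1_form a b c u v w u' v' w' ^+ 2
    * P2_form a b c (u * u') (v * v') (w * w').
Proof.
move=> i1 i2 i4 p p' t t' s s' n2 n3 Hom Hq Hw Hw'.
have Dw : w = - u - v by rewrite -[LHS]subr0 -Hw; ring.
have Dw' : w' = - u' - v' by rewrite -[LHS]subr0 -Hw'; ring.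
have [A [B [Du Dv]]] : exists A B, u = A + B /\ v = om * A + om ^+ 2 * B.
  exists ((u + om ^+ 2 * v + om * w) / 3), ((u + om * v + om ^+ 2 * w) / 3).
  by rewrite Dw; split; field: Hom.
(* Conjugation exchanges [om] and [om ^+ 2], so [A'], the conjugate of [A], now goes with [om ^+ 2]
   and [B'] with [om]. *)
have [B' [A' [Du' Dv']]] :
    exists B' A', u' = B' + A' /\ v' = om * B' + om ^+ 2 * A'.
  exists ((u' + om ^+ 2 * v' + om * w') / 3),
    ((u' + om * v' + om ^+ 2 * w') / 3).
  by rewrite Dw'; split; field: Hom.
have [e [f [f' [Da Db Dc]]]] : exists e f f', [/\ a = e + f + f',
    b = e + om * f + om ^+ 2 * f' & c = e + om ^+ 2 * f + om * f'].
  exists ((a + b + c) / 3), ((a + om ^+ 2 * b + om * c) / 3),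
    ((a + om * b + om ^+ 2 * c) / 3).
  by split; field: Hom.
have {}Dw : w = om ^+ 2 * A + om * B by rewrite Dw Du Dv; ring: Hom.
have {}Dw' : w' = om ^+ 2 * B' + om * A' by rewrite Dw' Du' Dv'; ring: Hom.
have Eq : q * q' = e ^+ 3 + f ^+ 3 + f' ^+ 3 - 3 * e * f * f'.
  by rewrite Hq Da Db Dc; ring: Hom.
have E1 : i1 = 3 * (A * A' + B * B' + e).
  by rewrite /i1 Du Dv Dw Du' Dv' Dw' Da Db Dc; ring: Hom.
have E2 : i2 = 3 * ((A * A') ^+ 2 + 4 * A * B * A' * B' + (B * B') ^+ 2
    + (A * A' + B * B') * e + A * B' * f + B * A' * f' + e ^+ 2 - f * f').
  by rewrite /i2 Du Dv Dw Du' Dv' Dw' Da Db Dc; ring: Hom.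
have Ep : p = - 3 * A * B by rewrite /p Du Dv Dw; ring: Hom.
have Ep' : p' = - 3 * A' * B' by rewrite /p' Du' Dv' Dw'; ring: Hom.
have Et : t = A ^+ 3 + B ^+ 3 + q by rewrite /t Du Dv Dw; ring: Hom.
have Et' : t' = A' ^+ 3 + B' ^+ 3 + q' by rewrite /t' Du' Dv' Dw'; ring: Hom.
have Es : s = 3 * (A ^+ 2 * B' + B ^+ 2 * A' - A * f' - B * f).
  by rewrite /s Du Dv Dw Du' Dv' Dw' Da Db Dc; ring: Hom.
have Es' : s' = 3 * (A' ^+ 2 * B + B' ^+ 2 * A - A' * f - B' * f').
  by rewrite /s' Du Dv Dw Du' Dv' Dw' Da Db Dc; ring: Hom.
set S := i1 * i2 - 3 * (t * t') + s * s'.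
pose r := 3 * ((A ^+ 3 - B ^+ 3) * q' - (A' ^+ 3 - B' ^+ 3) * q
    - 3 * A * B' * (e * f - f' ^+ 2) + 3 * B * A' * (e * f' - f ^+ 2)
    + f ^+ 3 - f' ^+ 3).
(* [1 + 2 * om] is a square root of -3: [i4] and [S - i4] differ by the sign of that root, so their
   product involves only [S ^+ 2 + 3 * r ^+ 2]. *)
have E4 : 2 * i4 = S + (1 + 2 * om) * r.
  rewrite /S /r E1 E2 Et Et' Es Es' /i4.
  rewrite Du Dv Dw Du' Dv' Dw' Da Db Dc; ring: Hom Eq.
have EQ : 4 * (i4 * (S - i4)) = S ^+ 2 + 3 * r ^+ 2.
  have -> : 4 * (i4 * (S - i4)) = 2 * i4 * (2 * S - 2 * i4) by ring.
  by rewrite E4; ring: Hom.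
have n4 : 4 != 0 :> K by rewrite (natrM _ 2 2) mulf_neq0.
apply: (mulfI n4); clear E4; move: EQ; rewrite {}/S.
rewrite Ep Ep' Et Et' Es Es' {}E1 {}E2 => EQ.
rewrite (P_reduced_fourier Eq EQ) /=; congr (_ * (_ ^+ 2 * _)).
  rewrite /P1_form Du Dv Dw Du' Dv' Dw' Da Db Dc; ring: Hom.
set h := A * A' + B * B'; set z := A * B'; set z' := B * A'.
pose c2 := f * f' - 3 * z * z' - z * f - z' * f'.
pose c3 := z * (z - f') ^+ 2 + z' * (z' - f) ^+ 2 - 4 * e * z * z'.
rewrite -/c2 -/c3.
(* With [g(T) = T^3 + e T^2 + c2 T + c3], the cubic attached to these arguments is [27 g(Y/3 + h)].
   Its discriminant is [3^6] times that of [g]; dividing by 3 gives the factor 243. *)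
have -> : P2_form a b c (u * u') (v * v') (w * w') =
  cubic_form (3 * e + 9 * h) (3 * c2 - 3 * e ^+ 2 - 18 * h ^+ 2 - 12 * e * h)
    (9 * (c3 + h ^+ 3 + e * h ^+ 2 + c2 * h)).
  rewrite /P2_form /c2 /c3 /h /z /z' Du Dv Dw Du' Dv' Dw' Da Db Dc.
  congr cubic_form; ring: Hom.
by rewrite /cubic_form; ring.
Qed.

(** * The trace invariants *)

(** The halves recover [i7], [i8], [i11], [i13] from [G], [H], [L], [M]. The expression in place of
    [i16] comes from [Re(w^2) = 2 (Re w)^2 - |w|^2], where [i16 = Re(w^2)], [L = 2 Re w] and
    [|w|^2 = i3^2 i5 i6]. *)
Lemma P_coef_sum (R : realType) (i1 i2 i3 i4 i5 i6 G H L M : R) :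
  \sum_(k < 7) \sum_(l < 5)
    P_coef i1 i2 i4 i5 ((G + H) / 2) ((G - H) / 2) (L / 2) (M / 2)
      (L ^+ 2 / 2 - i3 ^+ 2 * i5 * i6) k l * i3 ^+ k * i6 ^+ l
  = P_reduced i1 i2 i3 i5 i6 G H L M (i4 * (i1 * i2 - 3 * i5 + i6 - i4)).
Proof.
(* Explicit lists of numerals let the [match] of [P_coef] reduce. *)
have sum7_5 (F : nat -> nat -> R) : \sum_(k < 7) \sum_(l < 5) F k l =
    \sum_(k <- [:: 0; 1; 2; 3; 4; 5; 6]%N)
      \sum_(l <- [:: 0; 1; 2; 3; 4]%N) F k l.
  by rewrite !big_ord_recl !big_ord0 !big_cons !big_nil.
rewrite (sum7_5 (fun k l => P_coef _ _ _ _ _ _ _ _ _ k l * _ ^+ k * _ ^+ l)).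
rewrite !big_cons !big_nil; cbv beta iota delta [P_coef].
rewrite /P_reduced /P_quad.
by field.
Qed.

Lemma rmorph_P_reduced (K K' : comPzRingType) (h : {rmorphism K -> K'})
    (i1 i2 i3 i5 i6 G H L M Q : K) :
  h (P_reduced i1 i2 i3 i5 i6 G H L M Q) =
  P_reduced (h i1) (h i2) (h i3) (h i5) (h i6) (h G) (h H) (h L) (h M) (h Q).
Proof. by rewrite /P_reduced /P_quad; ring. Qed.

Section TraceInvariants.

Variable R : realType.
Implicit Types (z p t s : R[i]) (X : 'M[R[i]]_3).
Local Open Scope complex_scope.
Local Open Scope sesquilinear_scope.
Local Open Scope ring_scope.

Lemma ReC z : (complex.Re z)%:C = (z + z^*) / 2.
Proof. exact: ReJ_add. Qed.

Lemma abs2C z : (abs2 z)%:C = z * z^*.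
Proof. by rewrite -normCK /abs2 rmorphXn. Qed.

Lemma Re_realC z : complex.Im z = 0 -> (complex.Re z)%:C = z.
Proof. by case: z => a b /= ->. Qed.

Lemma ReD z t : complex.Re (z + t) = complex.Re z + complex.Re t.
Proof. by case: z; case: t. Qed.

Lemma ReN z : complex.Re (- z) = - complex.Re z.
Proof. by case: z. Qed.

Lemma Re_natM n z : complex.Re (n%:R * z) = n%:R * complex.Re z.
Proof.
case: z => x y; rewrite -[n%:R in LHS](rmorph_nat (real_complex R)) /=.
by rewrite mul0r subr0.
Qed.

Lemma Re_sqr z : complex.Re (z ^+ 2) = 2 * complex.Re z ^+ 2 - abs2 z.
Proof.
apply: complexI; rewrite rmorphB /= abs2C rmorphM /= rmorphXn /= !ReC rmorphXn.
by rewrite rmorph_nat /=; field.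
Qed.

Lemma abs2M z t : abs2 (z * t) = abs2 z * abs2 t.
Proof. by rewrite /abs2 ComplexField.Normc.normcM exprMn. Qed.

Lemma abs2J z : abs2 z^* = abs2 z.
Proof. by apply: complexI; rewrite !abs2C conjCK mulrC. Qed.

Lemma abs2_nat n : abs2 (n%:R : R[i]) = n%:R ^+ 2.
Proof. by apply: complexI; rewrite abs2C rmorphXn !rmorph_nat. Qed.

Lemma abs2N z : abs2 (- z) = abs2 z.
Proof. by apply: complexI; rewrite !abs2C rmorphN mulrNN. Qed.

(** The parameters stand for [tr X^2 = - 2 p], [tr X^3 = 3 t] and [tr (X^2 Y) = s]; with these
    scalings the rational prefactors of the invariants cancel. *)
Lemma P_coef_sum_complex (i1 i2 i4 : R) p t s :
  (\sum_(k < 7) \sum_(l < 5)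
    P_coef i1 i2 i4 (9^-1 * abs2 (3 * t))
      (6^-1 * complex.Re (- 2 * p^* * (3 * s ^+ 2 + 3 * t * s^*)))
      (6^-1 * complex.Re (- 2 * p^* * (3 * s ^+ 2 - 3 * t * s^*)))
      (12^-1 * complex.Re ((- 2 * p) ^+ 2 * (3 * t^*) * s^*))
      (72^-1 * complex.Re ((3 * t) ^+ 2 * (- 2 * p^*) ^+ 3))
      (144^-1 * complex.Re ((- 2 * p) ^+ 4 * (3 * t^*) ^+ 2 * s^* ^+ 2)) k l
    * (4^-1 * abs2 (- 2 * p)) ^+ k * abs2 s ^+ l)%:C
  = P_reduced i1%:C i2%:C (p * p^*) (t * t^*) (s * s^*)
    (- (p^* * s ^+ 2 + p * s^* ^+ 2)) (- (p^* * t * s^* + p * t^* * s))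
    (p ^+ 2 * t^* * s^* + p^* ^+ 2 * t * s)
    (- (t ^+ 2 * p^* ^+ 3 + t^* ^+ 2 * p ^+ 3))
    (i4%:C * (i1%:C * i2%:C - 3 * (t * t^*) + s * s^* - i4%:C)).
Proof.
(* These are the values of [G], [H], [L], [M]; a doubled real part is the sum of a number and its
   conjugate, hence polynomial in [p], [t], [s] and their conjugates. *)
set g := - (2 * complex.Re (p^* * s ^+ 2)).
set h := - (2 * complex.Re (p^* * t * s^*)).
set l := 2 * complex.Re (p ^+ 2 * t^* * s^*).
set m := - (2 * complex.Re (t ^+ 2 * p^* ^+ 3)).
have -> : 9^-1 * abs2 (3 * t) = abs2 t by rewrite abs2M abs2_nat; field.
have -> : 4^-1 * abs2 (- 2 * p) = abs2 p.
  by rewrite abs2M abs2N abs2_nat; field.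
have -> : 6^-1 * complex.Re (- 2 * p^* * (3 * s ^+ 2 + 3 * t * s^*))
    = (g + h) / 2.
  have -> : - 2 * p^* * (3 * s ^+ 2 + 3 * t * s^*)
      = - (6 * (p^* * s ^+ 2)) + - (6 * (p^* * t * s^*)) by ring.
  by rewrite ReD !ReN !Re_natM /g /h; field.
have -> : 6^-1 * complex.Re (- 2 * p^* * (3 * s ^+ 2 - 3 * t * s^*))
    = (g - h) / 2.
  have -> : - 2 * p^* * (3 * s ^+ 2 - 3 * t * s^*)
      = - (6 * (p^* * s ^+ 2)) + 6 * (p^* * t * s^*) by ring.
  by rewrite ReD !ReN !Re_natM /g /h; field.
have -> : 12^-1 * complex.Re ((- 2 * p) ^+ 2 * (3 * t^*) * s^*) = l / 2.
  have -> : (- 2 * p) ^+ 2 * (3 * t^*) * s^* = 12 * (p ^+ 2 * t^* * s^*).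
    by ring.
  by rewrite Re_natM /l; field.
have -> : 72^-1 * complex.Re ((3 * t) ^+ 2 * (- 2 * p^*) ^+ 3) = m / 2.
  have -> : (3 * t) ^+ 2 * (- 2 * p^*) ^+ 3 = - (72 * (t ^+ 2 * p^* ^+ 3)).
    by ring.
  by rewrite ReN Re_natM /m; field.
have -> : 144^-1 * complex.Re ((- 2 * p) ^+ 4 * (3 * t^*) ^+ 2 * s^* ^+ 2)
    = l ^+ 2 / 2 - abs2 p ^+ 2 * abs2 t * abs2 s.
  have -> : (- 2 * p) ^+ 4 * (3 * t^*) ^+ 2 * s^* ^+ 2
      = 144 * (p ^+ 2 * t^* * s^*) ^+ 2 by ring.
  by rewrite Re_natM Re_sqr !abs2M !abs2J /l; field.
have two_Re z w : z^* = w -> (2 * complex.Re z)%:C = z + w.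
  by move=> <-; rewrite rmorphM rmorph_nat /=; exact/esym/addcJ.
have Eg : g%:C = - (p^* * s ^+ 2 + p * s^* ^+ 2).
  by rewrite rmorphN /= (two_Re _ (p * s^* ^+ 2)) // rmorphM rmorphXn /= conjCK.
have Eh : h%:C = - (p^* * t * s^* + p * t^* * s).
  by rewrite rmorphN /= (two_Re _ (p * t^* * s)) // !rmorphM /= !conjCK.
have El : l%:C = p ^+ 2 * t^* * s^* + p^* ^+ 2 * t * s.
  by rewrite (two_Re _ (p^* ^+ 2 * t * s)) // !rmorphM /= !conjCK.
have Em : m%:C = - (t ^+ 2 * p^* ^+ 3 + t^* ^+ 2 * p ^+ 3).
  rewrite rmorphN /= (two_Re _ (t^* ^+ 2 * p ^+ 3)) //.
  by rewrite rmorphM !rmorphXn /= conjCK.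
clearbody g h l m.
rewrite P_coef_sum rmorph_P_reduced /= Eg Eh El Em !abs2C.
congr P_reduced.
move: (abs2 t) (abs2 s) (abs2C t) (abs2C s) => i5 i6 <- <-.
ring.
Qed.

Lemma trace_conj X : (\tr X)^* = \tr (X^t*).
Proof. by rewrite trace_map_mx mxtrace_tr. Qed.

(** For a traceless [X], [p] is the second elementary symmetric function of the eigenvalues and [t]
    is the determinant. The traces [i1], [i2], [i4] are real, so they agree with the real parts
    taken in [P]. *)
Lemma P_traceE X : let Y := X^t* in
  let i1 := \tr (X *m Y) in let i2 := \tr (X *m X *m (Y *m Y)) in
  let i4 := \tr (X *m Y *m (X *m X) *m (Y *m Y)) in
  let p := - \tr (X *m X) / 2 in let t := \tr (X *m X *m X) / 3 in
  let s := \tr (X *m X *m Y) in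
  (P X)%:C = P_reduced i1 i2 (p * p^*) (t * t^*) (s * s^*)
    (- (p^* * s ^+ 2 + p * s^* ^+ 2)) (- (p^* * t * s^* + p * t^* * s))
    (p ^+ 2 * t^* * s^* + p^* ^+ 2 * t * s)
    (- (t ^+ 2 * p^* ^+ 3 + t^* ^+ 2 * p ^+ 3))
    (i4 * (i1 * i2 - 3 * (t * t^*) + s * s^* - i4)).
Proof.
move=> Y i1 i2 i4 p t s.
have [] := trace_inv_real X; rewrite -/Y.
move=> /Re_realC Ei1 /Re_realC Ei2 /Re_realC Ei4.
have YK : Y^t* = X by apply/matrixP => j k; rewrite !mxE conjCK.
have XK : X^t* = Y by [].
rewrite /P; cbv zeta; rewrite -/Y; clearbody Y.
have adjM (A B : 'M[R[i]]_3) : (A *m B)^t* = B^t* *m A^t*.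
  by rewrite trmx_mul map_mxM.
have trX2 : \tr (X *m X) = - 2 * p by rewrite /p; field.
have trX3 : \tr (X *m X *m X) = 3 * t by rewrite /t; field.
have trY2 : \tr (Y *m Y) = - 2 * p^*.
  by rewrite -XK -adjM -trace_conj trX2 rmorphM rmorphN rmorph_nat.
have trY3 : \tr (Y *m Y *m Y) = 3 * t^*.
  by rewrite -mulmxA -XK -!adjM -trace_conj trX3 rmorphM rmorph_nat.
have trXY2 : \tr (X *m (Y *m Y)) = s^*.
  by rewrite /s trace_conj !adjM XK YK.
rewrite trX2 trX3 trY2 trY3 trXY2.
by rewrite -[i1]Ei1 -[i2]Ei2 -[i4]Ei4 -P_coef_sum_complex.
Qed.

End TraceInvariants.

(** * Explicit three by three matrices and their traces *)

Lemma sum_I3 (V : nmodType) (F : 'I_3 -> V) :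
  \sum_j F j = F e1 + F e2 + F e3.
Proof.
rewrite !big_ord_recl big_ord0 addr0 addrA.
by congr (F _ + F _ + F _); apply: val_inj.
Qed.

Lemma mulmx3E (S : pzSemiRingType) (X Y : 'M[S]_3) j k :
  (X *m Y) j k = X j e1 * Y e1 k + X j e2 * Y e2 k + X j e3 * Y e3 k.
Proof. by rewrite mxE sum_I3. Qed.

Lemma mxtrace3 (S : pzSemiRingType) (X : 'M[S]_3) :
  \tr X = X e1 e1 + X e2 e2 + X e3 e3.
Proof. exact: sum_I3. Qed.

Definition mx3 (S : Type) (x0 a11 a12 a13 a21 a22 a23 a31 a32 a33 : S) :
    'M[S]_3 :=
  \matrix_(j, k) nth x0 (nth [::] [:: [:: a11; a12; a13]; [:: a21; a22; a23];
                                    [:: a31; a32; a33]] j) k.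

Lemma mx3_eta (S : Type) (x0 : S) (X : 'M[S]_3) :
  X = mx3 x0 (X e1 e1) (X e1 e2) (X e1 e3) (X e2 e1) (X e2 e2) (X e2 e3)
          (X e3 e1) (X e3 e2) (X e3 e3).
Proof.
apply/matrixP => -[[|[|[|//]]] ?] [[|[|[|//]]] ?]; rewrite mxE /=;
  by congr (X _ _); apply: val_inj.
Qed.

Lemma mulmx3 (S : pzSemiRingType) (a11 a12 a13 a21 a22 a23 a31 a32 a33
    b11 b12 b13 b21 b22 b23 b31 b32 b33 : S) :
  mx3 0 a11 a12 a13 a21 a22 a23 a31 a32 a33
    *m mx3 0 b11 b12 b13 b21 b22 b23 b31 b32 b33
  = mx3 0
    (a11 * b11 + a12 * b21 + a13 * b31) (a11 * b12 + a12 * b22 + a13 * b32)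
    (a11 * b13 + a12 * b23 + a13 * b33)
    (a21 * b11 + a22 * b21 + a23 * b31) (a21 * b12 + a22 * b22 + a23 * b32)
    (a21 * b13 + a22 * b23 + a23 * b33)
    (a31 * b11 + a32 * b21 + a33 * b31) (a31 * b12 + a32 * b22 + a33 * b32)
    (a31 * b13 + a32 * b23 + a33 * b33).
Proof. by rewrite [LHS](mx3_eta 0) !mulmx3E !mxE. Qed.

(** The letters of [Y] are independent of those of [X] instead of conjugate to them, which leaves
    polynomial identities. The traces are given in the shape that [P_reduced_factor] takes as
    input. *)
Lemma traces_mx3 (K : comPzRingType) (x y z u v w x' y' z' u' v' w' : K) :
  u + v + w = 0 -> u' + v' + w' = 0 ->
  let X := mx3 0 u z 0 0 v x y 0 w in
  let Y := mx3 0 u' 0 y' z' v' 0 0 x' w' in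
  let a := x * x' in let b := y * y' in let c := z * z' in
  let q := x * y * z in let q' := x' * y' * z' in
  [/\ \tr (X *m Y) = u * u' + v * v' + w * w' + a + b + c,
      \tr (X *m X *m (Y *m Y)) = (u * u') ^+ 2 + (v * v') ^+ 2 + (w * w') ^+ 2
        + a * (u * u') + b * (v * v') + c * (w * w') + a * b + b * c + c * a,
      \tr (X *m Y *m (X *m X) *m (Y *m Y)) =
        (u * u') ^+ 3 + (v * v') ^+ 3 + (w * w') ^+ 3
        + (u * u' + c) * (w * w' * c + a * c) + (u * u') ^+ 2 * c
        + (v * v' + a) * (u * u' * a + a * b) + (v * v') ^+ 2 * a
        + (w * w' + b) * (v * v' * b + b * c) + (w * w') ^+ 2 * b
        + (q * u' ^+ 2 * v' - c * v * v' * v * w' - a * c * u * v')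
        + (q * v' ^+ 2 * w' - a * w * w' * w * u' - b * a * v * w')
        + (q * w' ^+ 2 * u' - b * u * u' * u * v' - c * b * w * u')
        + (q' * u ^+ 2 * v - c * v' * v * v' * w - a * c * u' * v)
        + (q' * v ^+ 2 * w - a * w' * w * w' * u - b * a * v' * w)
        + (q' * w ^+ 2 * u - b * u' * u * u' * v - c * b * w' * u)
   & [/\ \tr (X *m X) = - 2 * (u * v + v * w + w * u),
      \tr (X *m X *m X) = 3 * (u * v * w + q)
    & \tr (X *m X *m Y) = u ^+ 2 * u' + v ^+ 2 * v' + w ^+ 2 * w'
        - (a * u + b * v + c * w)]].
Proof.
move=> Hw Hw' X Y a b c q q'.
have Dw : w = - u - v by rewrite -[LHS]subr0 -Hw; ring.
have Dw' : w' = - u' - v' by rewrite -[LHS]subr0 -Hw'; ring.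
(* The vanishing trace turns off-diagonal sums such as [u * z + z * v] into one monomial,
   [- w * z]. *)
have -> : X *m X = mx3 0 (u ^+ 2) (- w * z) (z * x) (x * y) (v ^+ 2) (- u * x)
      (- v * y) (y * z) (w ^+ 2).
  by rewrite /X mulmx3 Dw; congr mx3; ring.
have -> : Y *m Y = mx3 0 (u' ^+ 2) (x' * y') (- v' * y') (- w' * z') (v' ^+ 2)
      (y' * z') (z' * x') (- u' * x') (w' ^+ 2).
  by rewrite /Y mulmx3 Dw'; congr mx3; ring.
rewrite /X /Y !mulmx3 !mxtrace3 !mxE /= /a /b /c /q /q'.
by split; [ring | ring | ring | rewrite Dw; split; ring].
Qed.

(** * The factorization of [P] on [LI] *)

Section RestrictionToLI.

Variable R : realType.
Local Open Scope complex_scope.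
Local Open Scope sesquilinear_scope.
Local Open Scope ring_scope.

Lemma P1_formE (A : 'M[R[i]]_3) :
  let u := A e1 e1 in let v := A e2 e2 in let w := A e3 e3 in
  let x := A e2 e3 in let y := A e3 e1 in let z := A e1 e2 in
  (P1 A)%:C = P1_form (x * x^*) (y * y^*) (z * z^*) u v w u^* v^* w^*.
Proof.
move=> u v w x y z; rewrite /P1 -/u -/v -/w -/x -/y -/z /P1_form -!rmorphB.
clearbody u v w x y z.
rewrite (_ : forall a b, abs2 (a * b ^+ 2) = abs2 a * abs2 b ^+ 2); last first.
  by move=> a b; rewrite !abs2M.
rewrite !abs2M.
(* Each factor is paired with its conjugate, so that the products fold back into [abs2]. *)
have -> (a b c a' b' c' : R[i]) :
    a * b * c * (a' * b' * c') = (a * a') * (b * b') * (c * c').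
  by ring.
rewrite -!abs2C.
ring.
Qed.

Lemma cube_root_of_unity : {om : R[i] | om ^+ 2 = - om - 1}.
Proof.
exists ((sqrtC (- 3) - 1) / 2).
have := sqrtCK (- 3 : R[i]); move: (sqrtC _) => r Hr.
by field: Hr.
Qed.

Lemma rmorph_P2_form (K K' : comPzRingType) (h : {rmorphism K -> K'})
    (a b c U V W : K) :
  h (P2_form a b c U V W) = P2_form (h a) (h b) (h c) (h U) (h V) (h W).
Proof. by rewrite /P2_form /cubic_form; ring. Qed.

(** The identity is checked in [R[i]], which contains a primitive cube root of unity; injectivity of
    the embedding of [R] brings it back. *)
Lemma P_LI (A : 'M[R[i]]_3) : LI R A ->
  P A = P1 A ^+ 2 * P2_form (abs2 (A e2 e3)) (abs2 (A e3 e1)) (abs2 (A e1 e2))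
     (abs2 (A e1 e1)) (abs2 (A e2 e2)) (abs2 (A e3 e3)).
Proof.
move=> [trA A13 A21 A32]; have [om Hom] := cube_root_of_unity.
apply: complexI; rewrite rmorphM rmorphXn /= P1_formE P_traceE.
have {}trA : A e1 e1 + A e2 e2 + A e3 e3 = 0 by rewrite -mxtrace3.
have := mx3_eta 0 A; rewrite A13 A21 A32; move: trA.
move: (A e1 e1) (A e2 e2) (A e3 e3) (A e2 e3) (A e3 e1) (A e1 e2).
move=> u v w x y z trA ->.
have trA' : u^* + v^* + w^* = 0 by rewrite -!rmorphD trA rmorph0.
have -> : (mx3 0 u z 0 0 v x y 0 w)^t* = mx3 0 u^* 0 y^* z^* v^* 0 0 x^* w^*.
  by rewrite [LHS](mx3_eta 0) !mxE /= rmorph0.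
move: (traces_mx3 x y z x^* y^* z^* trA trA'); cbv zeta.
move: (mx3 0 u z 0 0 v x y 0 w) (mx3 0 u^* 0 y^* z^* v^* 0 0 x^* w^*) => X Y.
move=> [-> -> -> [-> -> ->]].
have -> : - (- 2 * (u * v + v * w + w * u)) / 2 = u * v + v * w + w * u.
  by field.
have -> : 3 * (u * v * w + x * y * z) / 3 = u * v * w + x * y * z by field.
set a := x * x^*; set b := y * y^*; set c := z * z^*.
set q := x * y * z; set q' := x^* * y^* * z^*.
have -> : (u * v + v * w + w * u)^* = u^* * v^* + v^* * w^* + w^* * u^*.
  by rewrite !rmorphD !rmorphM.
have -> : (u * v * w + q)^* = u^* * v^* * w^* + q'.
  by rewrite !rmorphD !rmorphM.
have -> : (u ^+ 2 * u^* + v ^+ 2 * v^* + w ^+ 2 * w^*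
           - (a * u + b * v + c * w))^*
    = u * u^* ^+ 2 + v * v^* ^+ 2 + w * w^* ^+ 2
      - (a * u^* + b * v^* + c * w^*).
  rewrite rmorphB !rmorphD !rmorphM /= !conjCK /a /b /c.
  by ring.
rewrite (P_reduced_factor _ _ Hom _ trA trA') ?pnatr_eq0 //; last first.
  by rewrite /q /q' /a /b /c; ring.
by rewrite rmorph_P2_form /= !abs2C.
Qed.

End RestrictionToLI.

(** * The integer polynomial *)

Definition coord (k : nat) : {mpoly int[10]} := 'X_(inord k).

Definition sqnorm (p q : {mpoly int[10]}) : {mpoly int[10]} := p ^+ 2 + q ^+ 2.

(** Consecutive pairs of coordinates are the real and imaginary parts of [x], [y], [z], [u], [v].
    The last squared modulus is that of [u + v = - w]. *)
Definition P2 : {mpoly int[10]} :=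
  P2_form (sqnorm (coord 0) (coord 1)) (sqnorm (coord 2) (coord 3))
    (sqnorm (coord 4) (coord 5)) (sqnorm (coord 6) (coord 7))
    (sqnorm (coord 8) (coord 9))
    (sqnorm (coord 6 + coord 8) (coord 7 + coord 9)).

Lemma dhomog_natl n c d (p : {mpoly int[n]}) :
  p \is d.-homog -> c%:R * p \is d.-homog.
Proof. by move=> hp; rewrite mulr_natl rpredMn. Qed.

(** The discriminant of a monic cubic is isobaric of weight 6, when [k], [m], [r] receive the
    weights 1, 2, 3. *)
Lemma dhomog_cubic_form n d (k m r : {mpoly int[n]}) :
  k \is d.-homog -> m \is (2 * d).-homog -> r \is (3 * d).-homog ->
  cubic_form k m r \is (6 * d).-homog.
Proof.
move=> hk hm hr.
have hk2 : k ^+ 2 \is (2 * d).-homog by rewrite mulnC dhomogMn.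
have hk3 : k ^+ 3 \is (3 * d).-homog by rewrite mulnC dhomogMn.
have split (i j : nat) (p q : {mpoly int[n]}) : (i + j = 6 * d)%N ->
    p \is i.-homog -> q \is j.-homog -> p * q \is (6 * d).-homog.
  by move=> <-; apply: dhomogM.
rewrite /cubic_form !(rpredB, rpredD) //.
- apply: (split (4 * d)%N (2 * d)%N); first by rewrite -mulnDl.
    rewrite (_ : (4 * d = 2 * d * 2)%N); last by rewrite mulnAC.
    by rewrite dhomogMn ?rpredD ?dhomog_natl.
  by rewrite rpredD ?dhomog_natl.
- by apply: (split (3 * d)%N (3 * d)%N); rewrite ?dhomog_natl // -mulnDl.
- apply: (split (3 * d)%N (3 * d)%N) => //; first by rewrite -mulnDl.
  rewrite (_ : 3 * d = d + 2 * d)%N; last by rewrite -mulSn.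
  by rewrite dhomogM ?dhomog_natl.
- by rewrite dhomog_natl // (_ : (6 * d = 3 * d * 2)%N) ?dhomogMn // mulnAC.
Qed.

Lemma dhomog_P2_form n d (a b c U V W : {mpoly int[n]}) :
  a \is d.-homog -> b \is d.-homog -> c \is d.-homog ->
  U \is d.-homog -> V \is d.-homog -> W \is d.-homog ->
  P2_form a b c U V W \is (6 * d).-homog.
Proof.
move=> ha hb hc hU hV hW.
have h2 (p q : {mpoly int[n]}) : p \is d.-homog -> q \is d.-homog ->
    p * q \is (2 * d).-homog.
  by move=> hp hq; rewrite mul2n -addnn dhomogM.
have h3 (p q : {mpoly int[n]}) : p \is (2 * d).-homog -> q \is d.-homog ->
    p * q \is (3 * d).-homog.
  by move=> hp hq; rewrite mulSnr dhomogM.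
apply: dhomog_cubic_form; rewrite ?rpredN !(rpredB, rpredD, dhomog_natl) //;
  by do ?[apply: h3 | apply: h2 | rewrite !(rpredB, rpredD, dhomog_natl)].
Qed.

Lemma dhomog_P2 : P2 \is 12.-homog.
Proof.
have hX k : coord k \is 1.-homog by rewrite dhomogX; apply/eqP/mdeg1.
have hS p q : p \is 1.-homog -> q \is 1.-homog -> sqnorm p q \is 2.-homog.
  move=> hp hq; apply: rpredD; first exact: (dhomogMn 2 hp).
  exact: (dhomogMn 2 hq).
by rewrite (@dhomog_P2_form _ 2) ?hS // rpredD.
Qed.

Lemma P2_neq0 : P2 != 0.
Proof.
(* At the point [x = 1], [y = z = u = v = 0], the arguments of [cubic_form] are 1, 0, 0 and its
   value is 1. *)
pose v (j : 'I_10) : int := (nat_of_ord j == 0%N)%:R.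
apply/eqP => /(congr1 (meval v)); rewrite meval0 rmorph_P2_form /sqnorm.
by rewrite !(rmorphD, rmorphXn) /= !mevalXU /v !inordK.
Qed.

Lemma eval_P2 (R : realType) (A : 'M[R[i]]_3) : LI R A ->
  eval_LI P2 A = P2_form (abs2 (A e2 e3)) (abs2 (A e3 e1)) (abs2 (A e1 e2))
     (abs2 (A e1 e1)) (abs2 (A e2 e2)) (abs2 (A e3 e3)).
Proof.
move=> [trA _ _ _].
have abs2E (z : R[i]) : abs2 z = complex.Re z ^+ 2 + complex.Im z ^+ 2.
  by case: z => x y; rewrite /abs2 /= sqr_sqrtr // addr_ge0 ?sqr_ge0.
have -> : A e3 e3 = - (A e1 e1 + A e2 e2).
  by apply/eqP; rewrite -addr_eq0 addrC -mxtrace3; apply/eqP.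
rewrite abs2N !abs2E.
rewrite /eval_LI.
pose h := (meval (real_coords A) \o map_mpoly intr) : {rmorphism _ -> _}.
rewrite -[LHS]/(h P2) rmorph_P2_form.
have hX k : h (coord k) = real_coords A (inord k).
  by rewrite /h /= /coord map_mpolyX mevalXU.
rewrite /sqnorm !(rmorphD, rmorphXn) !hX /real_coords !inordK //=.
by case: (A e1 e1) (A e2 e2) => ? ? [].
Qed.

(** * Smooth unitary paths *)

Section SmoothPaths.

Variable R : realType.
Implicit Types f g : R -> R.

(* An algebra of functions stable under differentiation, hence smooth. *)
Inductive trigonometric : (R -> R) -> Prop :=
| trig_cst c : trigonometric (fun=> c)
| trig_cos c : trigonometric (fun t => cos (c * t))
| trig_sin c : trigonometric (fun t => sin (c * t))
| trig_add f g : trigonometric f -> trigonometric g ->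
    trigonometric (fun t => f t + g t)
| trig_mul f g : trigonometric f -> trigonometric g ->
    trigonometric (fun t => f t * g t).

Lemma is_derive_cosM (c t : R) :
  is_derive t 1 (fun t => cos (c * t)) (- c * sin (c * t)).
Proof.
have -> : (fun t => cos (c * t)) = cos \o (c \*: id) by [].
by apply: is_derive_eq; rewrite /= scaler1 mulrC mulrN mulNr.
Qed.

Lemma is_derive_sinM (c t : R) :
  is_derive t 1 (fun t => sin (c * t)) (c * cos (c * t)).
Proof.
have -> : (fun t => sin (c * t)) = sin \o (c \*: id) by [].
by apply: is_derive_eq; rewrite /= scaler1 mulrC.
Qed.

Lemma trigonometric_derive f : trigonometric f ->
  exists2 df, trigonometric df & forall t : R, is_derive t 1 f (df t).
Proof.
elim=> [c|c|c|{}f g _ [df hdf fE] _ [dg hdg gE]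
       |{}f g hf [df hdf fE] hg [dg hdg gE]].
- by exists (fun=> 0) => [|t]; [exact: trig_cst | exact: is_derive_cst].
- exists (fun t => - c * sin (c * t)); last exact: is_derive_cosM.
  by apply: trig_mul; [exact: trig_cst | exact: trig_sin].
- exists (fun t => c * cos (c * t)); last exact: is_derive_sinM.
  by apply: trig_mul; [exact: trig_cst | exact: trig_cos].
- exists (fun t => df t + dg t); first exact: trig_add.
  by move=> t; apply: is_deriveD.
- exists (fun t => f t * dg t + g t * df t).
    by apply: trig_add; apply: trig_mul.
  by move=> t; apply: is_deriveM.
Qed.

Lemma trigonometric_derive1 f : trigonometric f ->
  trigonometric (derive1 f) /\ forall t : R, derivable f t 1.
Proof.
move=> /trigonometric_derive[df hdf fE]; split=> [|t]; last by case: (fE t).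
suff -> : derive1 f = df by [].
by apply/funext => t; rewrite derive1E; apply/derive_val.
Qed.

Lemma trigonometric_smooth f : trigonometric f -> smooth f.
Proof.
move=> hf n; suff /trigonometric_derive1[] : trigonometric (derive1n n f) by [].
by elim: n => // n; rewrite derive1nS => /trigonometric_derive1[].
Qed.

End SmoothPaths.

(** Each of the three summands involves a single pair of indices, hence generates a rotation with a
    closed form. *)
Lemma skew_mx3 (K : comNzRingType) (k1 k2 k3 k1' k2' k3' : K) :
  mx3 0 0 k3 (- k2') (- k3') 0 k1 k2 (- k1') 0 =
    k3 *: delta_mx e1 e2 - k3' *: delta_mx e2 e1
    + (k1 *: delta_mx e2 e3 - k1' *: delta_mx e3 e2)
    + (k2 *: delta_mx e3 e1 - k2' *: delta_mx e1 e3).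
Proof.
by apply/matrixP => -[[|[|[|//]]] ?] [[|[|[|//]]] ?]; rewrite !mxE /=; ring.
Qed.

(** Since [J^4 = - J^2], the product is [1 + (2 b - b^2 - a^2) J^2]. The values [a = sin],
    [b = 1 - cos] satisfy the condition, and give Rodrigues' formula. *)
Lemma mulmx_rotation (K : comNzRingType) n (J : 'M[K]_n) (a b : K) :
  J *m (J *m J) = - J -> a ^+ 2 = 2 * b - b ^+ 2 ->
  (1%:M + a *: J + b *: (J *m J)) *m (1%:M - a *: J + b *: (J *m J)) = 1%:M.
Proof.
move=> J3 Eab; have J3' : J *m J *m J = - J by rewrite -mulmxA J3.
have J4 : J *m J *m (J *m J) = - (J *m J) by rewrite mulmxA J3' mulNmx.
rewrite !(mulmxDl, mulmxDr, mulmxN, mul1mx, mulmx1).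
rewrite -!(scalemxAl, scalemxAr).
rewrite J3 J3' J4; move: (J *m J) => J2.
by apply/matrixP => j l; rewrite !mxE; ring: Eab.
Qed.

(** * Complex and matrix-valued trigonometric paths *)

Section ComplexPaths.

Variable R : realType.
Local Open Scope complex_scope.
Local Open Scope sesquilinear_scope.
Local Open Scope ring_scope.

Implicit Types (f g : R -> R) (p q : R -> R[i]) (M N : R -> 'M[R[i]]_3).

Lemma trigonometric_derive1D f g (t : R) :
  trigonometric f -> trigonometric g ->
  derive1 (fun s => f s + g s) t = derive1 f t + derive1 g t.
Proof.
move=> /trigonometric_derive1[_ hf] /trigonometric_derive1[_ hg].
by rewrite !derive1E deriveD.
Qed.

Lemma trigonometric_derive1M f g (t : R) :
  trigonometric f -> trigonometric g ->
  derive1 (fun s => f s * g s) t = derive1 f t * g t + f t * derive1 g t.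
Proof.
move=> /trigonometric_derive1[_ hf] /trigonometric_derive1[_ hg].
rewrite !derive1E.
 rewrite deriveM.
 rewrite addrC.
 congr (_ + _).
 exact: mulrC.
 by [].
 by [].
Qed.

(** Real and imaginary parts are tracked separately because [smooth_curve] and [velocity] are
    defined through them. *)
Definition ctrig p : Prop :=
  trigonometric (fun t => complex.Re (p t)) /\
  trigonometric (fun t => complex.Im (p t)).

Definition cderive p (t : R) : R[i] :=
  derive1 (fun s => complex.Re (p s)) t
  +i* derive1 (fun s => complex.Im (p s)) t.

Lemma ctrig_cst z : ctrig (fun=> z).
Proof. by split; exact: trig_cst. Qed.

Lemma cderive_cst z t : cderive (fun=> z) t = 0.
Proof. by rewrite /cderive !derive1_cst. Qed.

Lemma ctrigD p q : ctrig p -> ctrig q -> ctrig (fun t => p t + q t).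
Proof.
move=> [p1 p2] [q1 q2]; split.
  have -> : (fun t => complex.Re (p t + q t)) =
    (fun t => complex.Re (p t) + complex.Re (q t)).
    by apply/funext => t; rewrite ReD.
  exact: trig_add.
have -> : (fun t => complex.Im (p t + q t)) =
  (fun t => complex.Im (p t) + complex.Im (q t)).
  by apply/funext => t; case: (p t); case: (q t).
exact: trig_add.
Qed.

Lemma cderiveD p q t : ctrig p -> ctrig q ->
  cderive (fun s => p s + q s) t = cderive p t + cderive q t.
Proof.
move=> [p1 p2] [q1 q2]; rewrite /cderive.
have -> : (fun t => complex.Re (p t + q t)) =
    (fun t => complex.Re (p t) + complex.Re (q t)).
  by apply/funext => s; rewrite ReD.
have -> : (fun t => complex.Im (p t + q t)) =
  (fun t => complex.Im (p t) + complex.Im (q t)).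
  by apply/funext => s; case: (p s); case: (q s).
by rewrite !trigonometric_derive1D.
Qed.

Lemma ReM_fun p q : (fun t => complex.Re (p t * q t)) = (fun t =>
  complex.Re (p t) * complex.Re (q t)
  + (- 1) * (complex.Im (p t) * complex.Im (q t))).
Proof.
by apply/funext => t; case: (p t); case: (q t) => * /=; rewrite mulN1r.
Qed.

Lemma ImM_fun p q : (fun t => complex.Im (p t * q t)) = (fun t =>
  complex.Re (p t) * complex.Im (q t) + complex.Im (p t) * complex.Re (q t)).
Proof. by apply/funext => t; case: (p t); case: (q t). Qed.

Lemma ctrigM p q : ctrig p -> ctrig q -> ctrig (fun t => p t * q t).
Proof.
move=> [p1 p2] [q1 q2]; split; rewrite ?ReM_fun ?ImM_fun.
  apply: trig_add; last apply: trig_mul; [|exact: trig_cst|];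
  exact: trig_mul.
by apply: trig_add; exact: trig_mul.
Qed.

Lemma cderiveM p q t : ctrig p -> ctrig q ->
  cderive (fun s => p s * q s) t = cderive p t * q t + p t * cderive q t.
Proof.
move=> [p1 p2] [q1 q2]; rewrite /cderive ReM_fun ImM_fun.
have c1 := trig_cst (- 1 : R).
rewrite !(trigonometric_derive1D, trigonometric_derive1M) //;
  try exact: trig_mul;
  last by apply: trig_mul => //; exact: trig_mul.
rewrite derive1_cst; case: (p t) (q t) => a b [c d] /=.
by apply/eqP; rewrite eq_complex /=; apply/andP; split; apply/eqP; ring.
Qed.

Lemma ctrig_conj p : ctrig p -> ctrig (fun t => (p t)^*).
Proof.
move=> [p1 p2]; split.
  have -> // : (fun t => complex.Re (p t)^*) = (fun t => complex.Re (p t)).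
  by apply/funext => t; case: (p t).
have -> : (fun t => complex.Im (p t)^*) = (fun t => - 1 * complex.Im (p t)).
  by apply/funext => t; case: (p t) => * /=; rewrite mulN1r.
by apply: trig_mul => //; exact: trig_cst.
Qed.

Lemma cderive_conj p t : ctrig p ->
  cderive (fun s => (p s)^*) t = (cderive p t)^*.
Proof.
move=> [p1 p2]; rewrite /cderive.
have -> : (fun t => complex.Re (p t)^*) = (fun t => complex.Re (p t)).
  by apply/funext => s; case: (p s).
have -> : (fun t => complex.Im (p t)^*) = (fun t => - 1 * complex.Im (p t)).
  by apply/funext => s; case: (p s) => * /=; rewrite mulN1r.
rewrite trigonometric_derive1M //; last exact: trig_cst.
by rewrite derive1_cst mul0r add0r mulN1r.
Qed.

Lemma ctrig_real f : trigonometric f -> ctrig (fun t => (f t)%:C).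
Proof. by split => //; exact: trig_cst. Qed.

Lemma cderive_real f t : cderive (fun s => (f s)%:C) t = (derive1 f t)%:C.
Proof. by rewrite /cderive /= derive1_cst. Qed.

Definition mtrig M : Prop := forall j k, ctrig (fun t => M t j k).

Lemma mtrig_smooth M : mtrig M -> smooth_curve M.
Proof.
by move=> hM j k; have [h1 h2] := hM j k; split; exact: trigonometric_smooth.
Qed.

Lemma mtrig_cst (A : 'M[R[i]]_3) : mtrig (fun=> A).
Proof. by move=> j k; exact: ctrig_cst. Qed.

Lemma velocityE M t j k : velocity M t j k = cderive (fun s => M s j k) t.
Proof. by rewrite mxE. Qed.

Lemma velocity_cst (A : 'M[R[i]]_3) t : velocity (fun=> A) t = 0.
Proof. by apply/matrixP => j k; rewrite velocityE cderive_cst mxE. Qed.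

Lemma mul_path_entry M N j k : (fun t => (M t *m N t) j k) = (fun t =>
  M t j e1 * N t e1 k + M t j e2 * N t e2 k + M t j e3 * N t e3 k).
Proof. by apply/funext => t; rewrite mulmx3E. Qed.

Lemma mtrigM M N : mtrig M -> mtrig N -> mtrig (fun t => M t *m N t).
Proof.
move=> hM hN j k; rewrite mul_path_entry.
by do ![apply: ctrigD]; exact: ctrigM.
Qed.

Lemma velocityM M N t : mtrig M -> mtrig N ->
  velocity (fun s => M s *m N s) t = velocity M t *m N t + M t *m velocity N t.
Proof.
move=> hM hN; apply/matrixP => j k.
rewrite velocityE mul_path_entry [RHS]mxE !mulmx3E !velocityE.
have h l := ctrigM (hM j l) (hN l k).
rewrite !cderiveD //; last exact: ctrigD.
rewrite !cderiveM //.
ring.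
Qed.

Lemma mtrig_adj M : mtrig M -> mtrig (fun t => (M t)^t*).
Proof.
move=> hM j k; have -> : (fun t => (M t)^t* j k) = (fun t => (M t k j)^*).
  by apply/funext => t; rewrite !mxE.
exact: ctrig_conj.
Qed.

Lemma velocity_adj M t : mtrig M ->
  velocity (fun s => (M s)^t*) t = (velocity M t)^t*.
Proof.
move=> hM; apply/matrixP => j k; rewrite velocityE.
have -> : (fun t => (M t)^t* j k) = (fun t => (M t k j)^*).
  by apply/funext => s; rewrite !mxE.
by rewrite cderive_conj // !mxE.
Qed.

(** * Unitary paths with a prescribed velocity at the identity *)

Definition unitary_path M (K : 'M[R[i]]_3) : Prop :=
  [/\ mtrig M, forall t, M t \is unitarymx, M 0 = 1%:M & velocity M 0 = K].

(** By Leibniz's rule at the identity velocities add, so the product of paths for generators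
    replaces the exponential of a sum. *)
Lemma unitary_pathM M N K L : unitary_path M K -> unitary_path N L ->
  unitary_path (fun t => M t *m N t) (K + L).
Proof.
move=> [hM uM M0 M1] [hN uN N0 N1]; split.
- exact: mtrigM.
- by move=> t; exact: mul_unitarymx.
- by rewrite M0 N0 mulmx1.
- by rewrite velocityM // M0 N0 M1 N1 mulmx1 mul1mx.
Qed.

(* Since [J ^ 3 = - J], the path is [t |-> exp (c t J)]. *)
Lemma rotation_path (J : 'M[R[i]]_3) (c : R) :
  J^t* = - J -> J *m (J *m J) = - J ->
  exists M, unitary_path M (c%:C *: J).
Proof.
move=> Jadj J3.
(* [k] is [1 - cos (c t)], written with the constructors of [trigonometric]. *)
pose s t := sin (c * t); pose k t := 1 + (- 1) * cos (c * t).
exists (fun t => 1%:M + (s t)%:C *: J + (k t)%:C *: (J *m J)).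
have hs : trigonometric s by exact: trig_sin.
have hk : trigonometric k.
  apply: trig_add; first exact: trig_cst.
  by apply: trig_mul; [exact: trig_cst | exact: trig_cos].
have entryE j l : (fun t => (1%:M + (s t)%:C *: J + (k t)%:C *: (J *m J)) j l) =
    (fun t => 1%:M j l + (s t)%:C * J j l + (k t)%:C * (J *m J) j l).
  by apply/funext => t; rewrite 5!mxE.
have hsJ j l : ctrig (fun t => (s t)%:C * J j l).
  by apply: ctrigM; [exact: ctrig_real | exact: ctrig_cst].
have hkJ j l : ctrig (fun t => (k t)%:C * (J *m J) j l).
  by apply: ctrigM; [exact: ctrig_real | exact: ctrig_cst].
split.
- move=> j l; rewrite entryE; apply: ctrigD => //; apply: ctrigD => //.
  exact: ctrig_cst.
- move=> t; apply/unitarymxP.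
  have Esk : s t ^+ 2 = 2 * k t - k t ^+ 2.
    have Hs : sin (c * t) ^+ 2 = 1 - cos (c * t) ^+ 2.
      by rewrite -(cos2Dsin2 (c * t)); ring.
    by rewrite /s /k; ring: Hs.
  move: (s t) (k t) Esk => x y Exy.
  have {}Exy : x%:C ^+ 2 = 2 * y%:C - y%:C ^+ 2.
    by rewrite -!rmorphXn Exy rmorphB rmorphM rmorph_nat.
  have -> : (1%:M + x%:C *: J + y%:C *: (J *m J))^t* =
      1%:M - x%:C *: J + y%:C *: (J *m J).
    have adjJJ : (J *m J)^t* = J *m J.
      by rewrite trmx_mul map_mxM Jadj mulNmx mulmxN opprK.
    apply/matrixP => j l.
    move/matrixP/(_ j l): adjJJ; move/matrixP/(_ j l): Jadj.
    rewrite !mxE => EJ EJJ.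
    rewrite !rmorphD !rmorphM /= EJ EJJ.
    have conjR (r : R) : (r%:C)^* = r%:C by exact: conjc_real.
    by rewrite !conjR conjC_nat eq_sym mulrN.
  exact: mulmx_rotation.
- by rewrite /s /k mulr0 sin0 cos0 mulr1 subrr !scale0r !addr0.
- apply/matrixP => j l; rewrite velocityE entryE !cderiveD //;
    try exact: ctrig_cst;
    last by apply: ctrigD => //; exact: ctrig_cst.
  have c1 := ctrig_cst; rewrite !cderiveM //; try exact: ctrig_real.
  rewrite !cderive_cst !cderive_real mxE.
  have -> : derive1 s 0 = c.
    rewrite derive1E; have := @is_derive_sinM R c 0 => /@derive_val ->.
    by rewrite mulr0 cos0 mulr1.
  have -> : derive1 k 0 = 0.
    rewrite trigonometric_derive1D; [|exact: trig_cst|]; last first.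
      by apply: trig_mul; [exact: trig_cst | exact: trig_cos].
    rewrite trigonometric_derive1M; [|exact: trig_cst|exact: trig_cos].
    rewrite !derive1_cst derive1E.
    have := @is_derive_cosM R c 0 => /@derive_val ->.
    by rewrite mulr0 sin0 !mulr0 mul0r !addr0.
  by rewrite rmorph0 mul0r !mulr0 !addr0 add0r [RHS]mxE.
Qed.

(** For [|b| = 1], the square of [J = b E_jl - b^* E_lj] is minus the projection onto the
    coordinates [j] and [l], whence [J^3 = - J]. The general case is a real multiple of such a
    [J]. *)
Lemma elementary_path (j l : 'I_3) (a : R[i]) : j != l ->
  exists M, unitary_path M (a *: delta_mx j l - a^* *: delta_mx l j).
Proof.
move=> jl.
pose r := ComplexField.Normc.normc a.
(* Polar form [a = r b] with [|b| = 1]; for [a = 0] the unit [b] is chosen to be 1. *)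
pose b := if a == 0 then 1 else a / r%:C.
have ab : a = r%:C * b.
  rewrite /b; case: eqP => [a0|/eqP a0].
    by rewrite mulr1 a0 /r a0 ComplexField.Normc.normc0.
  rewrite mulrCA divff ?mulr1 //.
  rewrite (inj_eq (@complexI R) _ 0).
  by apply: contra a0 => /eqP/ComplexField.Normc.eq0_normc ->.
have bb : b * b^* = 1.
  rewrite -normCK /b; case: eqP => [_|/eqP a0]; first by rewrite normr1 expr1n.
  have -> : r%:C = `|a| by [].
  by rewrite normrM normfV normr_id divff ?expr1n // normr_eq0.
pose J : 'M[R[i]]_3 := b *: delta_mx j l - b^* *: delta_mx l j.
have [||M hM] := @rotation_path J r.
- apply/matrixP => m n; rewrite !mxE rmorphB !rmorphM /= conjCK !conjC_nat.
  rewrite [in X in X - _]andbC [in X in _ - X]andbC.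
  ring.
- have lj : (l == j) = false by rewrite eq_sym; exact/negbTE.
  have JJ : J *m J = - (delta_mx j j + delta_mx l l).
    rewrite /J !(mulmxBl, mulmxBr, =^~ scalemxAl, =^~ scalemxAr).
    rewrite !mul_delta_mx_cond !eqxx lj (negbTE jl) !mulr0n !mulr1n !scaler0.
    rewrite !scalerA [b^* * b]mulrC bb !scale1r.
    by rewrite subr0 sub0r opprD addrC.
  rewrite JJ /J mulmxN !(mulmxBl, mulmxDr, =^~ scalemxAl).
  rewrite !mul_delta_mx_cond !eqxx lj (negbTE jl) !mulr0n !mulr1n.
  by rewrite !scaler0 sub0r subr0 addrC.
exists M; suff -> : a *: delta_mx j l - a^* *: delta_mx l j = r%:C *: J by [].
by rewrite /J scalerBr !scalerA -ab {2}ab rmorphM /= [(r%:C)^*]conjc_real.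
Qed.

Lemma skew_path (k1 k2 k3 : R[i]) : exists M,
  unitary_path M (mx3 0 0 k3 (- k2^*) (- k3^*) 0 k1 k2 (- k1^*) 0).
Proof.
have [M1 h1] := @elementary_path e1 e2 k3 isT.
have [M2 h2] := @elementary_path e2 e3 k1 isT.
have [M3 h3] := @elementary_path e3 e1 k2 isT.
have h := unitary_pathM (unitary_pathM h1 h2) h3.
exists (fun t => M1 t *m M2 t *m M3 t).
by rewrite skew_mx3; exact: h.
Qed.

End ComplexPaths.

(** * Transversality *)

(* [P1] times the first component of the solution [k] of [n x k + D k^* = c],
   where [n = (x, y, z)] and [D = diag (d1, d2, d3)]. *)
Definition bracket_inverse (K : comPzRingType)
    (x y z d1 d2 d3 x' y' z' d1' d2' d3' c1 c2 c3 c1' c2' c3' : K) : K :=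
  x * y' * z' * (d3 * d2' - d2 * d3') * c1
  + z' * (x * d1 * x' * d3' + y * d3 * y' * d2' + z * d3 * z' * d3'
          + d1 * d3 * d2' * d3') * c2
  - y' * (x * d1 * x' * d2' + y * d2 * y' * d2' + z * d2 * z' * d3'
          + d1 * d2 * d2' * d3') * c3
  + (x * x' * (x * d1 * x' + y * d2 * y' + z * d3 * z' + d1 * d2 * d3'
               + d1 * d3 * d2')
     + d2 * d3 * (y * y' * d2' + z * z' * d3' + d1 * d2' * d3')) * c1'
  + x * y' * (x * d1 * x' + y * d2 * y' + z * d3 * z' + d1 * d2 * d3') * c2'
  + x * z' * (x * d1 * x' + y * d2 * y' + z * d3 * z' + d1 * d3 * d2') * c3'.

(** The unknowns and their conjugates are treated as independent. This is the first equation of the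
    linear system; the other two follow by cyclic permutation of the letters. *)
Lemma bracket_inverseP (K : fieldType)
    (x y z u v w x' y' z' u' v' w' c1 c2 c3 c1' c2' c3' : K) :
  let d1 := v - w in let d2 := w - u in let d3 := u - v in
  let d1' := v' - w' in let d2' := w' - u' in let d3' := u' - v' in
  let D := P1_form (x * x') (y * y') (z * z') u v w u' v' w' in
  u + v + w = 0 -> u' + v' + w' = 0 -> D != 0 ->
  let k2 := bracket_inverse y z x d2 d3 d1 y' z' x' d2' d3' d1'
              c2 c3 c1 c2' c3' c1' / D in
  let k3 := bracket_inverse z x y d3 d1 d2 z' x' y' d3' d1' d2'
              c3 c1 c2 c3' c1' c2' / D in
  let k1' := bracket_inverse x' y' z' d1' d2' d3' x y z d1 d2 d3
              c1' c2' c3' c1 c2 c3 / D in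
  y * k3 - z * k2 + d1 * k1' = c1.
Proof.
move=> d1 d2 d3 d1' d2' d3' D Hw Hw' D0 k2 k3 k1'.
have Dw : w = - u - v by rewrite -[LHS]subr0 -Hw; ring.
have Dw' : w' = - u' - v' by rewrite -[LHS]subr0 -Hw'; ring.
(* The numerators are isolated as products with [D], so that multiplying the goal by [D] leaves a
   polynomial identity. *)
have E2 : k2 * D = _ := divfK D0 _.
have E3 : k3 * D = _ := divfK D0 _.
have E1 : k1' * D = _ := divfK D0 _.
apply: (mulIf D0); clearbody k2 k3 k1'.
have -> : (y * k3 - z * k2 + d1 * k1') * D
    = y * (k3 * D) - z * (k2 * D) + d1 * (k1' * D) by ring.
rewrite E1 E2 E3.
rewrite /bracket_inverse /D /P1_form /d1 /d2 /d3 /d1' /d2' /d3' Dw Dw'.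
ring.
Qed.

Section Transversality.

Variable R : realType.
Local Open Scope complex_scope.
Local Open Scope sesquilinear_scope.
Local Open Scope ring_scope.

(** [K] has zero diagonal: a diagonal part would only rescale the entries of [B] at these three
    positions, which vanish. *)
Lemma bracket_LI (x y z u v w k1 k2 k3 k1' k2' k3' : R[i]) :
  let B := mx3 0 u z 0 0 v x y 0 w in
  let K := mx3 0 0 k3 (- k2') (- k3') 0 k1 k2 (- k1') 0 in
  let V := K *m B - B *m K in
  [/\ V e3 e2 = - (y * k3 - z * k2 + (v - w) * k1'),
      V e1 e3 = - (z * k1 - x * k3 + (w - u) * k2')
    & V e2 e1 = - (x * k2 - y * k1 + (u - v) * k3')].
Proof.
by rewrite /= !mulmx3; split; rewrite !mxE /=; ring.
Qed.

(** The three cyclically permuted systems thus share one denominator. *)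
Lemma P1_form_cyclic (K : comPzRingType) (a b c u v w u' v' w' : K) :
  P1_form b c a v w u v' w' u' = P1_form a b c u v w u' v' w'.
Proof. by rewrite /P1_form; ring. Qed.

Lemma rmorph_bracket_inverse (K K' : comPzRingType) (h : {rmorphism K -> K'})
    (x y z d1 d2 d3 x' y' z' d1' d2' d3' c1 c2 c3 c1' c2' c3' : K) :
  h (bracket_inverse x y z d1 d2 d3 x' y' z' d1' d2' d3' c1 c2 c3 c1' c2' c3') =
  bracket_inverse (h x) (h y) (h z) (h d1) (h d2) (h d3) (h x') (h y') (h z')
    (h d1') (h d2') (h d3') (h c1) (h c2) (h c3) (h c1') (h c2') (h c3').
Proof. by rewrite /bracket_inverse; ring. Qed.

Lemma bracket_surjective (B M : 'M[R[i]]_3) : LI R B -> P1 B != 0 ->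
  exists k1 k2 k3, let K := mx3 0 0 k3 (- k2^*) (- k3^*) 0 k1 k2 (- k1^*) 0 in
  let V := K *m B - B *m K in
  [/\ V e3 e2 = M e3 e2, V e1 e3 = M e1 e3 & V e2 e1 = M e2 e1].
Proof.
move=> [trB B13 B21 B32] P1B.
have : (P1 B)%:C != 0 by rewrite (inj_eq (@complexI R) _ 0).
have {trB} : B e1 e1 + B e2 e2 + B e3 e3 = 0 by rewrite -mxtrace3.
have := P1_formE B; have := mx3_eta 0 B; rewrite B13 B21 B32.
move: (P1 B) (B e1 e1) (B e2 e2) (B e3 e3) (B e2 e3) (B e3 e1) (B e1 e2).
move=> r u v w x y z -> EP trB; rewrite EP => {}P1B.
have trB' : u^* + v^* + w^* = 0 by rewrite -!rmorphD trB rmorph0.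
(* The signs are those of the right-hand sides in [bracket_LI]. *)
pose c1 := - M e3 e2; pose c2 := - M e1 e3; pose c3 := - M e2 e1.
pose D := P1_form (x * x^*) (y * y^*) (z * z^*) u v w u^* v^* w^*.
pose k1 := bracket_inverse x y z (v - w) (w - u) (u - v) x^* y^* z^*
  (v^* - w^*) (w^* - u^*) (u^* - v^*) c1 c2 c3 c1^* c2^* c3^* / D.
pose k2 := bracket_inverse y z x (w - u) (u - v) (v - w) y^* z^* x^*
  (w^* - u^*) (u^* - v^*) (v^* - w^*) c2 c3 c1 c2^* c3^* c1^* / D.
pose k3 := bracket_inverse z x y (u - v) (v - w) (w - u) z^* x^* y^*
  (u^* - v^*) (v^* - w^*) (w^* - u^*) c3 c1 c2 c3^* c1^* c2^* / D.
exists k1, k2, k3.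
have DJ : D^* = D.
  by rewrite /D -EP; exact: conjc_real.
(* The denominator is real, so conjugating a component of the solution exchanges primed and unprimed
   letters, as in the term [k1'] of [bracket_inverseP]. *)
have EJ x0 y0 z0 d1 d2 d3 d1' d2' d3' a1 a2 a3 : 
  (bracket_inverse x0 y0 z0 d1 d2 d3 x0^* y0^* z0^* d1' d2' d3'
     a1 a2 a3 a1^* a2^* a3^* / D)^*
  = bracket_inverse x0^* y0^* z0^* d1^* d2^* d3^* x0 y0 z0 d1'^* d2'^* d3'^*
     a1^* a2^* a3^* a1 a2 a3 / D.
  by rewrite rmorphM fmorphV /= DJ rmorph_bracket_inverse /= !conjCK.
have trv : v + w + u = 0 by rewrite -trB; ring.
have trv' : v^* + w^* + u^* = 0 by rewrite -trB'; ring.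
have trw : w + u + v = 0 by rewrite -trB; ring.
have trw' : w^* + u^* + v^* = 0 by rewrite -trB'; ring.
have D2 : P1_form (y * y^*) (z * z^*) (x * x^*) v w u v^* w^* u^* = D.
  exact: P1_form_cyclic.
have D3 : P1_form (z * z^*) (x * x^*) (y * y^*) w u v w^* u^* v^* = D.
  by rewrite P1_form_cyclic.
have E1 := bracket_inverseP c1 c2 c3 c1^* c2^* c3^* trB trB' P1B.
have := @bracket_inverseP _ y z x _ _ _ y^* z^* x^* _ _ _
  c2 c3 c1 c2^* c3^* c1^* trv trv'.
cbv zeta; rewrite D2 => /(_ P1B) E2.
have := @bracket_inverseP _ z x y _ _ _ z^* x^* y^* _ _ _
  c3 c1 c2 c3^* c1^* c2^* trw trw'.
cbv zeta; rewrite D3 => /(_ P1B) E3.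
have K1 : k1^* = bracket_inverse x^* y^* z^*
  (v^* - w^*) (w^* - u^*) (u^* - v^*) x y z
  (v - w) (w - u) (u - v) c1^* c2^* c3^* c1 c2 c3 / D.
  by rewrite EJ !rmorphB /= !conjCK.
have K2 : k2^* = bracket_inverse y^* z^* x^*
  (w^* - u^*) (u^* - v^*) (v^* - w^*) y z x
  (w - u) (u - v) (v - w) c2^* c3^* c1^* c2 c3 c1 / D.
  by rewrite EJ !rmorphB /= !conjCK.
have K3 : k3^* = bracket_inverse z^* x^* y^*
  (u^* - v^*) (v^* - w^*) (w^* - u^*) z x y
  (u - v) (v - w) (w - u) c3^* c1^* c2^* c3 c1 c2 / D.
  by rewrite EJ !rmorphB /= !conjCK.
have [-> -> ->] := bracket_LI x y z u v w k1 k2 k3 k1^* k2^* k3^*.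
split; apply: oppr_inj; rewrite opprK.
- by rewrite K1; exact: E1.
- by rewrite K2; exact: E2.
- by rewrite K3; exact: E3.
Qed.

(** This gives the easy inclusion in transversality: tangent vectors to the orbit of a traceless
    matrix are traceless. *)
Lemma velocity_trace (g : R -> 'M[R[i]]_3) t :
  smooth_curve g -> (forall s, \tr (g s) = 0) -> \tr (velocity g t) = 0.
Proof.
move=> sg trg.
have d0 (f : 'I_3 -> R -> R) : (forall j, smooth (f j)) ->
    (forall s, f e1 s + f e2 s + f e3 s = 0) ->
    derive1 (f e1) t + derive1 (f e2) t + derive1 (f e3) t = 0.
  move=> sf f0; have df j : derivable (f j) t 1 by exact: (sf j 0%N).
  have <- : derive1 (fun s => f e1 s + f e2 s + f e3 s) t = 0.
    by rewrite (_ : (fun s => _) = (fun=> 0)) ?derive1_cst //; apply/funext.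
  by rewrite !derive1E deriveD ?deriveD //; exact: derivableD.
rewrite mxtrace3 !mxE; apply/eqP; rewrite eq_complex /=.
apply/andP; split; apply/eqP.
  apply: (d0 (fun j s => complex.Re (g s j j))) => [j|s].
    by case: (sg j j).
  by rewrite -!ReD -mxtrace3 trg.
apply: (d0 (fun j s => complex.Im (g s j j))) => [j|s]; first by case: (sg j j).
by have := congr1 (@complex.Im R) (trg s); rewrite mxtrace3;
  case: (g s e1 e1) (g s e2 e2) (g s e3 e3) => ? ? [? ?] [].
Qed.

Lemma adj_unitaryK (U : 'M[R[i]]_3) : U \is unitarymx -> U^t* *m U = 1%:M.
Proof. by move=> hU; rewrite -invmx_unitary // mulVmx // unitarymx_unit. Qed.

Lemma unitary_conj_trace (U X : 'M[R[i]]_3) : U \is unitarymx ->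
  \tr (U *m X *m U^t*) = \tr X.
Proof.
by move=> hU; rewrite mxtrace_mulC mulmxA adj_unitaryK // mul1mx.
Qed.

(** For the converse inclusion, a skew-Hermitian [K] is chosen so that [M - [K, B]] vanishes at the
    positions of [I]. The commutator is traceless, and tangent to the orbit through conjugation of
    [B] by a unitary path of velocity [K]. *)
Lemma transversal_P1 (A B : 'M[R[i]]_3) :
  L3 R A -> unitary_orbit A B -> LI R B -> P1 B != 0 -> transversal_at A B.
Proof.
move=> trA [U0 U0u EB] hB P1B; apply/seteqP; split=> M.
  move=> [N [V [[trN _ _ _] [g [sg gA _ <-]] ->]]].
  rewrite /L3 /= mxtraceD trN add0r; apply: velocity_trace => // s.
  by have [U Uu <-] := gA s; rewrite invmx_unitary // unitary_conj_trace.
move=> trM; have [k1 [k2 [k3]]] := bracket_surjective M hB P1B.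
have [U [hU Uu U0' U1]] := skew_path k1 k2 k3.
move: U1; set K := mx3 _ _ _ _ _ _ _ _ _ _ => U1 [V1 V2 V3].
have KJ : K^t* = - K.
  rewrite [LHS](mx3_eta 0) [RHS](mx3_eta 0) !mxE /= !rmorphN /= rmorph0.
  by rewrite !conjCK !opprK oppr0.
exists (M - (K *m B - B *m K)), (K *m B - B *m K); split; last by rewrite subrK.
  have trV : \tr (K *m B - B *m K) = 0.
    by rewrite linearB /= mxtrace_mulC subrr.
  split; last 3 first.
  - by rewrite [LHS]mxE [X in _ + X]mxE V2 subrr.
  - by rewrite [LHS]mxE [X in _ + X]mxE V3 subrr.
  - by rewrite [LHS]mxE [X in _ + X]mxE V1 subrr.
  by rewrite /L3 /= linearB /= trV subr0.
exists (fun t => U t *m B *m (U t)^t*); split.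
- apply: mtrig_smooth; apply: mtrigM; last exact: mtrig_adj.
  by apply: mtrigM => //; exact: mtrig_cst.
- move=> t; exists (U t *m U0); first exact: mul_unitarymx.
  rewrite invmx_unitary ?mul_unitarymx // trmx_mul map_mxM -EB invmx_unitary //.
  by rewrite !mulmxA.
- by rewrite U0' trmx1 map_mx1 mul1mx mulmx1.
have hUB : mtrig (fun t => U t *m B) by apply: mtrigM => //; exact: mtrig_cst.
rewrite velocityM //; last exact: mtrig_adj.
rewrite velocityM ?velocity_adj //; last exact: mtrig_cst.
(* Leibniz's rule leaves [K B + B K^*], with [K^* = - K]. *)
rewrite velocity_cst mulmx0 addr0 U0' U1 KJ trmx1 map_mx1 mul1mx mulmx1.
by rewrite mulmxN.
Qed.

(** * Unitary invariance of [P] *)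

Lemma P_trace_eq (X X' : 'M[R[i]]_3) : let Y := X^t* in let Y' := X'^t* in
  let tr_eq (w : 'M[R[i]]_3 -> 'M[R[i]]_3 -> 'M[R[i]]_3) :=
    \tr (w X Y) = \tr (w X' Y') in
  tr_eq (fun A B => A *m B) -> tr_eq (fun A B => A *m A *m (B *m B)) ->
  tr_eq (fun A B => A *m B *m (A *m A) *m (B *m B)) ->
  tr_eq (fun A B => A *m A) -> tr_eq (fun A B => A *m A *m A) ->
  tr_eq (fun A B => B *m B) -> tr_eq (fun A B => B *m B *m B) ->
  tr_eq (fun A B => A *m A *m B) -> tr_eq (fun A B => A *m (B *m B)) ->
  P X = P X'.
Proof.
move=> Y Y' tr_eq; rewrite /tr_eq; rewrite /P; cbv zeta; rewrite -/Y -/Y'.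
(* The adjoints become opaque letters, so each equation rewrites exactly one word. *)
by clearbody Y Y' => {tr_eq} E1 E2 E3 E4 E5 E6 E7 E8 E9;
  rewrite E1 E2 E3 E4 E5 E6 E7 E8 E9.
Qed.

(** Conjugation by [U] commutes with products and adjoints and preserves traces, hence preserves the
    trace of every word in [A] and its adjoint. *)
Lemma P_unitary_conj (U A : 'M[R[i]]_3) : U \is unitarymx ->
  P (U *m A *m U^t*) = P A.
Proof.
move=> hU; have UK := adj_unitaryK hU.
have adjE : (U *m A *m U^t*)^t* = U *m A^t* *m U^t*.
  have UKK : (U^t*)^t* = U by apply/matrixP => j k; rewrite !mxE conjCK.
  by rewrite !trmx_mul !map_mxM UKK mulmxA.
have trU X : \tr (U *m X *m U^t*) = \tr X := unitary_conj_trace X hU.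
have conjM X Y : (U *m X *m U^t*) *m (U *m Y *m U^t*) = U *m (X *m Y) *m U^t*.
  by rewrite !mulmxA -[U *m X *m U^t* *m U]mulmxA UK mulmx1.
apply: P_trace_eq; rewrite ?adjE;
  move: (U^t*) (A^t*) trU conjM => V B trU conjM;
  by rewrite !conjM trU.
Qed.

End Transversality.

Theorem proposition9p3 (R : realType) :
  (exists P2 : {mpoly int[10]},
     [/\ P2 \is 12.-homog, P2 != 0,
         forall A : 'M[R[i]]_3, LI R A -> P A = P1 A ^+ 2 * eval_LI P2 A
       & Gamma R `&` LI R =
           [set A | LI R A /\ P1 A = 0] `|`
           [set A | LI R A /\ eval_LI P2 A = 0]]) /\
  Theta R `<=` Gamma R.
Proof.
have PE (A : 'M[R[i]]_3) : LI R A -> P A = P1 A ^+ 2 * eval_LI P2 A.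
  by move=> hA; rewrite P_LI // eval_P2.
split.
  exists P2; split=> //; [exact: dhomog_P2 | exact: P2_neq0 |].
  apply/seteqP; split=> A /=.
    move=> [[_ PA0] hA]; move/eqP: PA0; rewrite PE // mulf_eq0 sqrf_eq0.
    by case/orP => /eqP; [left | right].
  case=> -[hA A0]; (do 2?split) => //; try by case: hA.
    by rewrite PE // A0 expr0n mul0r.
  by rewrite PE // A0 mulr0.
move=> A [trA ngA]; split=> //.
have [B [/= AB hB] ntB] :
    exists2 B, (unitary_orbit A `&` LI R) B & ~ transversal_at A B.
  apply: contrapT => nB; apply: ngA => B hB; apply: contrapT => ntB.
  by apply: nB; exists B.
have P1B : P1 B = 0.
  by apply/eqP; apply: contrapT => /negP P1B; apply: ntB; exact: transversal_P1.
have [U Uu EB] := AB.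
by rewrite -(P_unitary_conj A Uu) -invmx_unitary // EB PE // P1B expr0n mul0r.
Qed.
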